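(* Let $R$ be an associative ring with identity and $n\in\mathbb{N}$. If $\mathcal{P}(R)\subseteq\mathcal{SFI}^{\vee}$ and $\mathrm{fin.}\mathcal{SFI}(R)\le n$, then $(\mathcal{GP},\mathcal{GP}^{\perp})$ is a hereditary and complete cotorsion pair in $\mathrm{Mod}(R)$.
   Context: All modules are left $R$-modules; $\mathcal{P}(R)$ is the class of projective left $R$-modules; $\mathbb{N}=\{0,1,2,\dots\}$. For a class $\mathcal{X}$: $\mathcal{X}^{\perp_1}=\{M:\mathrm{Ext}^1_R(X,M)=0\ \forall X\in\mathcal{X}\}$, $\mathcal{X}^{\perp}=\{M:\mathrm{Ext}^i_R(X,M)=0\ \forall i\ge1,\ X\in\mathcal{X}\}$, and left orthogonals are defined analogously. $\mathcal{SFI}$ is the class of strongly FP-injective modules, i.e. modules $E$ with $\mathrm{Ext}^k_R(F,E)=0$ for all $k\ge1$ and all finitely presented modules $F$. $\mathrm{SFI\mbox{-}id}(M)$ is the least $m\ge0$ such that there is an exact sequence $0\to M\to E^0\to\cdots\to E^m\to0$ with all $E^i\in\mathcal{SFI}$ ($\infty$ if there is none). $\mathcal{SFI}^{\vee}$ is the class of modules $M$ with $\mathrm{SFI\mbox{-}id}(M)<\infty$. $\mathrm{fin.}\mathcal{SFI}(R):=\sup\{\mathrm{SFI\mbox{-}id}(M):M\in\mathcal{SFI}^{\vee}\}$. $\mathcal{GP}$ is the class of Gorenstein projective modules: cycles of acyclic complexes of projective modules that remain exact after applying $\mathrm{Hom}_R(-,P)$ for all $P\in\mathcal{P}(R)$.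 A pair $(\mathcal{X},\mathcal{Y})$ is a cotorsion pair if $\mathcal{X}={}^{\perp_1}\mathcal{Y}$ and $\mathcal{Y}=\mathcal{X}^{\perp_1}$; it is complete if for every module $M$ there is an exact sequence $0\to Y\to X\to M\to0$ with $X\in\mathcal{X}$, $Y\in\mathcal{Y}$; it is hereditary if $\mathrm{Ext}^{i}_R(X,Y)=0$ for all $i\ge1$, $X\in\mathcal{X}$, $Y\in\mathcal{Y}$. *)

(* Defs.v *)
From HB Require Import structures.
From mathcomp Require Import all_boot all_algebra.
From mathcomp Require Import boolp.

Set Implicit Arguments.
Unset Strict Implicit.
Unset Printing Implicit Defensive.

Import GRing.Theory.
Local Open Scope ring_scope.

(* The extended naturals: [None] stands for infinity. *)
Definition enat := option nat.

Definition le_enat (x y : enat) : bool :=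
  match x, y with
  | _, None => true
  | None, Some _ => false
  | Some m, Some n => (m <= n)%N
  end.

(* The least element of [A], with the convention min(empty) = infinity. *)
Definition enat_min (A : nat -> Prop) : enat :=
  if pselect (exists n, `[< A n >]) is left h then Some (ex_minn h) else None.

(* The least upper bound: infinity when no natural number bounds [S]. *)
Definition enat_sup (S : enat -> Prop) : enat :=
  enat_min (fun n => forall x, S x -> le_enat x (Some n)).

Section Modules.
Variable R : pzRingType.

(* Classes of left modules are plain predicates; [lmodType R] is large, so
   using the library's [set] here would needlessly constrain universes. *)
Definition modclass := lmodType R -> Prop.

Definition subclass (X Y : modclass) : Prop := forall M, X M -> Y M.

Definition surj (A B : lmodType R) (f : {linear A -> B}) : Prop :=
  forall y, exists x, f x = y.

Definition exact (A B C : lmodType R)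
    (f : {linear A -> B}) (g : {linear B -> C}) : Prop :=
  forall y, g y = 0 <-> exists x, f x = y.

Definition projective : modclass := fun P =>
  forall (A B : lmodType R) (g : {linear A -> B}) (f : {linear P -> B}),
    surj g -> exists h : {linear P -> A}, forall x, g (h x) = f x.

(* There is an exact sequence R^p -> R^q -> F -> 0. *)
Definition finitely_presented : modclass := fun F =>
  exists (p q : nat) (f : {linear 'rV[R]_p -> 'rV[R]_q})
         (g : {linear 'rV[R]_q -> F}),
    exact f g /\ surj g.

Record proj_resolution (X : lmodType R) := ProjResolution {
  res_obj : nat -> lmodType R;
  res_d : forall i, {linear res_obj i.+1 -> res_obj i};
  res_aug : {linear res_obj 0 -> X};
  res_projective : forall i, projective (res_obj i);
  res_exact : forall i, exact (res_d i.+1) (res_d i);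
  res_exact_aug : exact (res_d 0) res_aug;
  res_aug_surj : surj res_aug }.

(* The i-th cohomology of the cochain complex
     0 -> Hom(P_0, M) -> Hom(P_1, M) -> ...
   vanishes: every i-cocycle is an i-coboundary. *)
Definition cohomology_zero (X : lmodType R) (P : proj_resolution X)
    (M : lmodType R) (i : nat) : Prop :=
  forall f : {linear res_obj P i -> M},
    (forall x, f (res_d P i x) = 0) ->
    match i return {linear res_obj P i -> M} -> Prop with
    | 0%N => fun f => forall x, f x = 0
    | j.+1 => fun f =>
        exists g : {linear res_obj P j -> M}, forall x, f x = g (res_d P j x)
    end f.

(* Ext^i_R(X, M) = 0.  Ext^i_R(X, M) is the i-th cohomology of Hom_R(P, M) for
   a projective resolution P of X; every module has such a resolution, and the
   cohomology does not depend on which one is taken. *)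
Definition Ext_zero (i : nat) (X M : lmodType R) : Prop :=
  exists P : proj_resolution X, cohomology_zero P M i.

Definition rperp1 (X : modclass) : modclass :=
  fun M => forall A, X A -> Ext_zero 1 A M.

Definition lperp1 (Y : modclass) : modclass :=
  fun M => forall B, Y B -> Ext_zero 1 M B.

Definition rperp (X : modclass) : modclass :=
  fun M => forall i A, (1 <= i)%N -> X A -> Ext_zero i A M.

Definition SFI : modclass := fun E =>
  forall k F, (1 <= k)%N -> finitely_presented F -> Ext_zero k F E.

(* There is an exact sequence 0 -> M -> E^0 -> ... -> E^m -> 0 with all E^i in
   SFI; the sequence is continued by E^i = 0 for i > m, so that exactness at
   E^m says that the last map is onto. *)
Definition SFI_coresolution (M : lmodType R) (m : nat) : Prop :=
  exists (E : nat -> lmodType R) (d : forall i, {linear E i -> E i.+1})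
         (e : {linear M -> E 0%N}),
    [/\ forall i, (i <= m)%N -> SFI (E i),
        forall i, (m < i)%N -> forall x : E i, x = 0,
        injective e,
        exact e (d 0%N)
      & forall i, exact (d i) (d i.+1)].

Definition SFI_id (M : lmodType R) : enat := enat_min (SFI_coresolution M).

Definition SFI_vee : modclass := fun M => SFI_id M <> None.

Definition fin_SFI : enat :=
  enat_sup (fun x => exists2 M, SFI_vee M & x = SFI_id M).

(* An acyclic complex of projectives  ... -> P_i -> P_{i+1} -> ... , indexed by
   the integers, which stays exact under Hom_R(-, Q) for Q projective. As [i]
   ranges over [int], the position i + 1 ranges over all degrees. *)
Definition totally_acyclic (P : int -> lmodType R)
    (d : forall i : int, {linear P i -> P (i + 1)}) : Prop :=
  [/\ forall i, projective (P i),
      forall i, exact (d i) (d (i + 1))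
    & forall Q, projective Q -> forall i (f : {linear P (i + 1) -> Q}),
        (forall x, f (d i x) = 0) <->
        exists g : {linear P (i + 1 + 1) -> Q}, forall x, f x = g (d (i + 1) x)].

(* M is isomorphic to a cycle module Ker(P_i -> P_{i+1}). *)
Definition Gorenstein_projective : modclass := fun M =>
  exists (P : int -> lmodType R)
         (d : forall i : int, {linear P i -> P (i + 1)}),
    totally_acyclic d /\
    exists (i : int) (k : {linear M -> P i}), injective k /\ exact k (d i).

Definition cotorsion_pair (X Y : modclass) : Prop :=
  (forall M, X M <-> lperp1 Y M) /\ (forall M, Y M <-> rperp1 X M).

Definition complete_pair (X Y : modclass) : Prop :=
  forall M : lmodType R,
    exists (A B : lmodType R) (f : {linear B -> A}) (g : {linear A -> M}),
      [/\ X A, Y B, injective f, exact f g & surj g].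

Definition hereditary_pair (X Y : modclass) : Prop :=
  forall i A B, (1 <= i)%N -> X A -> Y B -> Ext_zero i A B.

End Modules.

(* Main.v *)
Require Import Defs.
From HB Require Import structures.
From mathcomp Require Import all_boot all_order all_algebra.
From mathcomp Require Import boolp classical_sets.

Set Implicit Arguments.
Unset Strict Implicit.
Unset Printing Implicit Defensive.

Import Order.TTheory GRing.Theory Num.Theory.
Local Open Scope ring_scope.

(** Call a module V of dimension at most m when Ext^k(F, V) = 0 for all finitely
    presented F and all k > m; by dimension shifting this is the same as having
    a coresolution of length m by strongly FP-injective modules. The hypotheses
    say that every module of finite dimension has dimension at most n, and that
    the projective modules are among them. Let W be the class of these modules
    and C its left orthogonal for Ext^1. The theorem follows from three facts.

    The pair (C, W) is complete ([orthogonal_embedding], [orthogonal_cover]).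
    Indeed W is the right orthogonal of a small family, the k-th syzygies with
    k >= n of the cokernels of matrices. In place of a transfinite small object
    argument, a module M is embedded in the module freely generated by M and by
    formal extensions of all the maps that have to be extended, formal
    extensions of maps involving formal extensions included
    ([special_embedding]). A map out of that module is defined by recursion on
    formal expressions, and this shows directly both that the embedding is
    injective and that its cokernel lies in C.

    Every module of C is Gorenstein projective ([orthogonal_Gorenstein]). Since
    W is closed under kernels of surjections (this is where the uniform bound
    enters) and contains the projectives, C and W have only projectives in
    common. Hence a special embedding of a module of C is an embedding in a
    projective module with cokernel in C; together with projective
    presentations this gives a complete resolution.

    Conversely Ext^1(G, V) = 0 for G Gorenstein projective and V in W
    ([Gorenstein_ext1]). Replacing V by its cosyzygies and G by its cosyzygies
    in a complete resolution reduces this to V = E strongly FP-injective, where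
    E need not be injective and nothing bounds the number of generators of G.
    An injective coresolution of E is then a pure exact complex, because all its
    cosyzygies are strongly FP-injective, and the point is that every chain map
    from a complex of projectives to a pure exact complex is null homotopic
    ([projective_null_homotopy]). For free modules one extends a partial
    homotopy, defined on some basis elements, by adding finitely many basis
    elements in each degree; modulo the previous ones these span a complex of
    finitely generated free modules, for which purity is applied to the
    cokernels of the differentials ([finite_null_homotopy]).

    Thus the Gorenstein projective modules are exactly C, their right orthogonal
    is W, and the three assertions can be read off. *)

(** * Choice of dependent families *)

Lemma dependent_choice (I : Type) (T : I -> Type) (P : forall i, T i -> Prop) :
  (forall i, exists y, P i y) -> exists f : forall i, T i, forall i, P i (f i).
Proof.
by move=> h; exists (fun i => sval (cid (h i))) => i; apply: svalP.
Qed.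

Lemma dependent_recursion (T : nat -> Type) (r : forall n, T n -> T n.+1 -> Prop) x0 :
  (forall n x, exists y, r n x y) ->
  exists f : forall n, T n, f 0%N = x0 /\ forall n, r n (f n) (f n.+1).
Proof.
move=> h; exists (nat_rect T x0 (fun n x => sval (cid (h n x)))); split=> // n.
exact: (svalP (cid (h n _))).
Qed.

(** * Modules presented by operations and a congruence *)

(** A set with operations that satisfy the module axioms only up to a congruence:
    submodules, quotients, free modules, coinduced modules and modules given by
    generators and relations are all obtained from it in the same way. *)
Record premodule (R : pzRingType) := Premodule {
  pm_car : Type;
  pm_rel : pm_car -> pm_car -> Prop;
  pm_zero : pm_car;
  pm_opp : pm_car -> pm_car;
  pm_add : pm_car -> pm_car -> pm_car;
  pm_scale : R -> pm_car -> pm_car;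
  pm_refl : forall x, pm_rel x x;
  pm_sym : forall x y, pm_rel x y -> pm_rel y x;
  pm_trans : forall x y z, pm_rel x y -> pm_rel y z -> pm_rel x z;
  pm_add_rel : forall x x' y y',
    pm_rel x x' -> pm_rel y y' -> pm_rel (pm_add x y) (pm_add x' y');
  pm_opp_rel : forall x x', pm_rel x x' -> pm_rel (pm_opp x) (pm_opp x');
  pm_scale_rel : forall a x x',
    pm_rel x x' -> pm_rel (pm_scale a x) (pm_scale a x');
  pm_addA : forall x y z,
    pm_rel (pm_add x (pm_add y z)) (pm_add (pm_add x y) z);
  pm_addC : forall x y, pm_rel (pm_add x y) (pm_add y x);
  pm_add0 : forall x, pm_rel (pm_add pm_zero x) x;
  pm_addN : forall x, pm_rel (pm_add (pm_opp x) x) pm_zero;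
  pm_scaleA : forall a b x,
    pm_rel (pm_scale a (pm_scale b x)) (pm_scale (a * b) x);
  pm_scale1 : forall x, pm_rel (pm_scale 1 x) x;
  pm_scaleDr : forall a x y,
    pm_rel (pm_scale a (pm_add x y)) (pm_add (pm_scale a x) (pm_scale a y));
  pm_scaleDl : forall a b x,
    pm_rel (pm_scale (a + b) x) (pm_add (pm_scale a x) (pm_scale b x)) }.

(** Classes are predicates, so that congruent elements have equal classes by
    extensionality. *)
Definition classes R (D : premodule R) : Type :=
  {A : pm_car D -> Prop | exists x, A = pm_rel x}.

HB.instance Definition _ R (D : premodule R) := gen_eqMixin (classes D).
HB.instance Definition _ R (D : premodule R) := gen_choiceMixin (classes D).

Section ClassesModule.
Variables (R : pzRingType) (D : premodule R).

Definition class_of (x : pm_car D) : classes D :=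
  exist _ (pm_rel x) (ex_intro _ x erefl).

Lemma class_of_eq x y : class_of x = class_of y <-> pm_rel x y.
Proof.
split=> [[e]|xy]; first by rewrite e; apply: pm_refl.
apply/eq_exist/funext => z; apply/propext; split => [xz|yz].
  by apply: pm_trans xz; apply: pm_sym.
exact: pm_trans yz.
Qed.

Lemma class_of_surj (q : classes D) : {x | q = class_of x}.
Proof.
apply: cid; case: q => A [x Ax]; exists x; exact: eq_exist.
Qed.

Definition class_repr q := sval (class_of_surj q).

Lemma class_reprK q : class_of (class_repr q) = q.
Proof. by rewrite /class_repr; case: (class_of_surj q). Qed.

Lemma class_reprP x : pm_rel (class_repr (class_of x)) x.
Proof. by apply/class_of_eq/class_reprK. Qed.

Definition cl_add q q' := class_of (pm_add (class_repr q) (class_repr q')).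
Definition cl_opp q := class_of (pm_opp (class_repr q)).
Definition cl_scale a q := class_of (pm_scale a (class_repr q)).
Definition cl_zero := class_of (pm_zero D).

Lemma cl_addE x y : cl_add (class_of x) (class_of y) = class_of (pm_add x y).
Proof. by apply/class_of_eq/pm_add_rel; apply: class_reprP. Qed.

Lemma cl_oppE x : cl_opp (class_of x) = class_of (pm_opp x).
Proof. by apply/class_of_eq/pm_opp_rel/class_reprP. Qed.

Lemma cl_scaleE a x : cl_scale a (class_of x) = class_of (pm_scale a x).
Proof. by apply/class_of_eq/pm_scale_rel/class_reprP. Qed.

Lemma cl_addA : associative cl_add.
Proof.
move=> p q r; rewrite -(class_reprK p) -(class_reprK q) -(class_reprK r).
by rewrite !cl_addE; apply/class_of_eq/pm_addA.
Qed.

Lemma cl_addC : commutative cl_add.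
Proof.
move=> p q; rewrite -(class_reprK p) -(class_reprK q).
by rewrite !cl_addE; apply/class_of_eq/pm_addC.
Qed.

Lemma cl_add0 : left_id cl_zero cl_add.
Proof.
by move=> p; rewrite -(class_reprK p) cl_addE; apply/class_of_eq/pm_add0.
Qed.

Lemma cl_addN : left_inverse cl_zero cl_opp cl_add.
Proof.
move=> p; rewrite -(class_reprK p) cl_oppE cl_addE.
exact/class_of_eq/pm_addN.
Qed.

HB.instance Definition _ :=
  GRing.isZmodule.Build (classes D) cl_addA cl_addC cl_add0 cl_addN.

Lemma cl_scaleA a b q : cl_scale a (cl_scale b q) = cl_scale (a * b) q.
Proof.
by rewrite -(class_reprK q) !cl_scaleE; apply/class_of_eq/pm_scaleA.
Qed.

Lemma cl_scale1 : left_id 1 cl_scale.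
Proof.
by move=> q; rewrite -(class_reprK q) cl_scaleE; apply/class_of_eq/pm_scale1.
Qed.

Lemma cl_scaleDr : right_distributive cl_scale +%R.
Proof.
move=> a p q; rewrite -(class_reprK p) -(class_reprK q) /GRing.add /=.
by rewrite !(cl_addE, cl_scaleE); apply/class_of_eq/pm_scaleDr.
Qed.

Lemma cl_scaleDl q : {morph cl_scale^~ q : a b / a + b}.
Proof.
move=> a b /=; rewrite -(class_reprK q) [in RHS]/GRing.add /=.
by rewrite !(cl_addE, cl_scaleE); apply/class_of_eq/pm_scaleDl.
Qed.

HB.instance Definition _ := GRing.Zmodule_isLmodule.Build R (classes D)
  cl_scaleA cl_scale1 cl_scaleDr cl_scaleDl.

Lemma class_ofD x y : class_of (pm_add x y) = class_of x + class_of y.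
Proof. by rewrite -cl_addE. Qed.

Lemma class_ofZ a x : class_of (pm_scale a x) = a *: class_of x.
Proof. by rewrite -cl_scaleE. Qed.

Lemma class_of0 : class_of (pm_zero D) = 0.
Proof. by []. Qed.

End ClassesModule.

(** * Linear maps, submodules, quotients, factorisations *)

Section Toolkit.
Variable R : pzRingType.
Implicit Types A B C E F G J K M N P Q V W X Y Z : lmodType R.

Definition mklin A B (f : A -> B) (h : linear f) : {linear A -> B} :=
  HB.pack f (GRing.isLinear.Build R A B *:%R f h).

Lemma mklinE A B (f : A -> B) (h : linear f) x : mklin h x = f x.
Proof. by []. Qed.

Lemma lcomp_linear A B C (g : {linear B -> C}) (f : {linear A -> B}) :
  linear (fun x => g (f x)).
Proof. by move=> a x y; rewrite !linearP. Qed.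

Definition lcomp A B C (g : {linear B -> C}) (f : {linear A -> B}) :=
  mklin (lcomp_linear g f).

Lemma lsub_linear A B (f g : {linear A -> B}) : linear (fun x => f x - g x).
Proof.
by move=> a x y; rewrite (linearP f) (linearP g) opprD addrACA scalerBr.
Qed.

Definition lsub A B (f g : {linear A -> B}) := mklin (lsub_linear f g).

Lemma ladd_linear A B (f g : {linear A -> B}) : linear (fun x => f x + g x).
Proof.
by move=> a x y; rewrite (linearP f) (linearP g) addrACA scalerDr.
Qed.

Definition ladd A B (f g : {linear A -> B}) := mklin (ladd_linear f g).

Lemma lid_linear A : linear (fun x : A => x).
Proof. by []. Qed.

Definition lid A := mklin (@lid_linear A).

Lemma lzero_linear A B : linear (fun _ : A => 0 : B).
Proof. by move=> a x y; rewrite scaler0 addr0. Qed.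

Definition lzero A B := mklin (@lzero_linear A B).

Lemma pairD A B (a a' : A) (b b' : B) :
  (a, b) + (a', b') = (a + a', b + b') :> (A * B)%type.
Proof. by []. Qed.

Lemma pairN A B (a : A) (b : B) : - (a, b) = (- a, - b) :> (A * B)%type.
Proof. by []. Qed.

Lemma lfst_linear A B : linear (fun z : A * B => z.1).
Proof. by []. Qed.
Definition lfst A B : {linear (A * B)%type -> A} := mklin (@lfst_linear A B).

Lemma lsnd_linear A B : linear (fun z : A * B => z.2).
Proof. by []. Qed.
Definition lsnd A B : {linear (A * B)%type -> B} := mklin (@lsnd_linear A B).

Lemma lpair_linear A B C (f : {linear A -> B}) (g : {linear A -> C}) :
  linear (fun x => (f x, g x)).
Proof. by move=> a x y; rewrite !linearP. Qed.
Definition lpair A B C (f : {linear A -> B}) (g : {linear A -> C}) :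
  {linear A -> (B * C)%type} := mklin (lpair_linear f g).

Definition submodule M (N : M -> Prop) :=
  N 0 /\ forall a x y, N x -> N y -> N (a *: x + y).

Lemma submoduleD M (N : M -> Prop) x y :
  submodule N -> N x -> N y -> N (x + y).
Proof. by case=> _ h /h h1 /h1; move/(_ 1); rewrite scale1r. Qed.

Lemma submoduleZ M (N : M -> Prop) a x : submodule N -> N x -> N (a *: x).
Proof. by case=> h0 h Nx; rewrite -[_ *: _]addr0; apply: h. Qed.

Lemma submoduleN M (N : M -> Prop) x : submodule N -> N x -> N (- x).
Proof. by move=> h Nx; rewrite -scaleN1r; apply: submoduleZ. Qed.

Lemma ker_submodule A B (f : {linear A -> B}) : submodule (fun x => f x = 0).
Proof.
split=> [|a x y fx fy]; first exact: linear0.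
by rewrite linearP fx fy scaler0 addr0.
Qed.

Lemma im_submodule A B (f : {linear A -> B}) :
  submodule (fun y => exists x, f x = y).
Proof.
split=> [|a _ _ [x <-] [y <-]]; first by exists 0; apply: linear0.
by exists (a *: x + y); rewrite linearP.
Qed.

Lemma ex_sub M (N : M -> Prop) : submodule N ->
  exists K (k : {linear K -> M}),
    injective k /\ forall x, N x <-> exists y, k y = x.
Proof.
move=> hN.
have hD (x y : {x | N x}) : N (sval x + sval y).
  by case: x y => [x Nx] [y Ny]; apply: submoduleD.
have hO (x : {x | N x}) : N (- sval x) by case: x => x Nx; apply: submoduleN.
have hZ a (x : {x | N x}) : N (a *: sval x).
  by case: x => x Nx; apply: submoduleZ.
unshelve epose (D := @Premodule R {x | N x} (fun x y => sval x = sval y)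
  (exist _ 0 hN.1) (fun x => exist _ _ (hO x)) (fun x y => exist _ _ (hD x y))
  (fun a x => exist _ _ (hZ a x)) _ _ _ _ _ _ _ _ _ _ _ _ _ _); simpl.
all: try by [].
- by move=> x y z -> ->.
- by move=> x x' y y' -> ->.
- by move=> x x' ->.
- by move=> a x x' ->.
- by move=> x y z; rewrite addrA.
- by move=> x y; rewrite addrC.
- by move=> x; rewrite add0r.
- by move=> x; rewrite addNr.
- by move=> a b x; rewrite scalerA.
- by move=> x; rewrite scale1r.
- by move=> a x y; rewrite scalerDr.
- by move=> a b x; rewrite scalerDl.
pose k (q : classes D) : M := sval (class_repr q).
have kE x : k (class_of (D := D) x) = sval x := class_reprP (D := D) x.
have klin : linear k.
  move=> a p q; rewrite -(class_reprK p) -(class_reprK q).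
  by rewrite -class_ofZ -class_ofD !kE.
exists (classes D), (mklin klin); split=> [p q|x].
  rewrite -(class_reprK p) -(class_reprK q) !mklinE !kE => e.
  exact/class_of_eq.
split=> [Nx|[q <-]].
  by exists (class_of (D := D) (exist _ x Nx)); rewrite mklinE kE.
by rewrite mklinE /k; apply: svalP.
Qed.

Lemma ex_quot M (N : M -> Prop) : submodule N ->
  exists (Q : lmodType R) (q : {linear M -> Q}), surj q /\ forall x, q x = 0 <-> N x.
Proof.
move=> hN.
unshelve epose (D := @Premodule R M (fun x y => N (x - y)) 0 -%R +%R
  (fun a x => a *: x)
  _ _ _ _ _ _ _ _ _ _ _ _ _ _); simpl.
all: try by [].
- by move=> x; rewrite subrr; apply: hN.1.
- by move=> x y /(submoduleN hN); rewrite opprB.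
- by move=> x y z /(submoduleD hN) h /h; rewrite addrA subrK.
- by move=> x x' y y' /(submoduleD hN) h /h; rewrite opprD addrACA.
- by move=> x x' /(submoduleN hN); rewrite opprB opprK addrC.
- by move=> a x x' /(submoduleZ a hN); rewrite scalerBr.
- by move=> x y z; rewrite addrA subrr; apply: hN.1.
- by move=> x y; rewrite (addrC x) subrr; apply: hN.1.
- by move=> x; rewrite add0r subrr; apply: hN.1.
- by move=> x; rewrite addNr subrr; apply: hN.1.
- by move=> a b x; rewrite scalerA subrr; apply: hN.1.
- by move=> x; rewrite scale1r subrr; apply: hN.1.
- by move=> a x y; rewrite scalerDr subrr; apply: hN.1.
- by move=> a b x; rewrite scalerDl subrr; apply: hN.1.
have qlin : linear (fun x : M => class_of (D := D) x : classes D).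
  by move=> a x y; rewrite -class_ofZ -class_ofD.
exists (classes D), (mklin qlin); split=> [q|x].
  by exists (class_repr q); apply: class_reprK.
rewrite mklinE -(class_of0 D); split=> [/class_of_eq /=|Nx].
  by rewrite subr0.
by apply/class_of_eq; rewrite /= subr0.
Qed.

Definition short_exact A B C (i : {linear A -> B}) (p : {linear B -> C}) :=
  [/\ injective i, exact i p & surj p].

Lemma inj_ker0 A B (f : {linear A -> B}) :
  (forall x, f x = 0 -> x = 0) -> injective f.
Proof.
move=> h x y e; apply/eqP; rewrite -subr_eq0; apply/eqP/h.
by rewrite linearB e subrr.
Qed.

Lemma inj_eq0 A B (f : {linear A -> B}) x : injective f -> f x = 0 <-> x = 0.
Proof.
by move=> fi; split=> [fx0|->]; [apply: fi; rewrite fx0|]; rewrite linear0.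
Qed.

Lemma exact_comp0 A B C (i : {linear A -> B}) (p : {linear B -> C}) x :
  exact i p -> p (i x) = 0.
Proof. by move=> h; apply/h; exists x. Qed.

Lemma ex_ker A B (f : {linear A -> B}) :
  exists K (k : {linear K -> A}), injective k /\ exact k f.
Proof.
by have [K [k [ki kN]]] := ex_sub (ker_submodule f); exists K, k.
Qed.

Lemma ex_ker_ses A B (p : {linear A -> B}) : surj p ->
  exists K (k : {linear K -> A}), short_exact k p.
Proof. by have [K [k [ki ke]]] := ex_ker p; exists K, k. Qed.

Lemma ex_coker_ses A B (i : {linear A -> B}) : injective i ->
  exists C (p : {linear B -> C}), short_exact i p.
Proof.
by have [C [p [ps pN]]] := ex_quot (im_submodule i); exists C, p.
Qed.

Lemma factor_surj A B M (q : {linear A -> B}) (f : {linear A -> M}) :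
  surj q -> (forall x, q x = 0 -> f x = 0) ->
  exists g : {linear B -> M}, forall x, g (q x) = f x.
Proof.
move=> qs h; have [s sK] := choice qs.
have key x y : q x = q y -> f x = f y.
  move=> e; apply/eqP; rewrite -subr_eq0 -linearB; apply/eqP/h.
  by rewrite linearB e subrr.
have glin : linear (fun y => f (s y)).
  move=> a x y; rewrite -(linearP f); apply: key.
  by rewrite (linearP q) !sK.
by exists (mklin glin) => x; rewrite mklinE; apply: key; rewrite sK.
Qed.

Lemma factor_inj A B M (i : {linear A -> B}) (f : {linear M -> B}) :
  injective i -> (forall x, exists y, i y = f x) ->
  exists g : {linear M -> A}, forall x, i (g x) = f x.
Proof.
move=> ii /choice[g gK].
have glin : linear g.
  by move=> a x y; apply: ii; rewrite (linearP i) !gK (linearP f).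
by exists (mklin glin) => x; rewrite mklinE gK.
Qed.

Lemma factor_ker A B C M (i : {linear A -> B}) (p : {linear B -> C})
    (f : {linear M -> B}) :
  injective i -> exact i p -> (forall x, p (f x) = 0) ->
  exists g : {linear M -> A}, forall x, i (g x) = f x.
Proof. by move=> ii e h; apply: factor_inj => // x; apply/e. Qed.

Lemma factor_coker A B C M (i : {linear A -> B}) (p : {linear B -> C})
    (f : {linear B -> M}) :
  surj p -> exact i p -> (forall x, f (i x) = 0) ->
  exists g : {linear C -> M}, forall x, g (p x) = f x.
Proof. by move=> ps e h; apply: factor_surj => // x /e[y <-]. Qed.

End Toolkit.

(** * Free and projective modules *)

Section Free.
Variable R : pzRingType.
Implicit Types A B C E F G J K M N P Q V W X Y Z : lmodType R.

Definition lincomb (I : Type) M (v : I -> M) (s : seq (R * I)) : M :=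
  \sum_(p <- s) p.1 *: v p.2.

Lemma lincomb_scale I M (v : I -> M) a s :
  lincomb v [seq (a * p.1, p.2) | p <- s] = a *: lincomb v s.
Proof.
rewrite /lincomb big_map scaler_sumr.
by apply: eq_bigr => p _; rewrite scalerA.
Qed.

Lemma lincomb_cat I M (v : I -> M) s t :
  lincomb v (s ++ t) = lincomb v s + lincomb v t.
Proof. exact: big_cat. Qed.

(** Formal combinations are identified when they agree in every module, so
    that the module axioms for them are those of an arbitrary module. *)
Lemma free_premodule (I : Type) : exists D : premodule R,
  exists c : seq (R * I) -> pm_car D, exists d : pm_car D -> seq (R * I),
  [/\ forall s, d (c s) = s,
      forall x y, pm_rel x y <->
        forall M (v : I -> M), lincomb v (d x) = lincomb v (d y),
      forall x y, pm_add x y = c (d x ++ d y) &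
      forall a x, pm_scale a x = c [seq (a * p.1, p.2) | p <- d x]].
Proof.
unshelve epose (D := @Premodule R (seq (R * I))
  (fun s t => forall M (v : I -> M), lincomb v s = lincomb v t)
  [::] (fun s => [seq (-1 * p.1, p.2) | p <- s]) cat
  (fun a s => [seq (a * p.1, p.2) | p <- s])
  _ _ _ _ _ _ _ _ _ _ _ _ _ _); simpl.
all: rewrite /=.
- by [].
- by move=> x y h M v.
- by move=> x y z h1 h2 M v; rewrite h1.
- by move=> x x' y y' h1 h2 M v; rewrite !lincomb_cat h1 h2.
- by move=> x x' h M v; rewrite !lincomb_scale h.
- by move=> a x x' h M v; rewrite !lincomb_scale h.
- by move=> x y z M v; rewrite catA.
- by move=> x y M v; rewrite !lincomb_cat addrC.
- by [].
- move=> x M v; rewrite lincomb_cat lincomb_scale scaleN1r addNr.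
  by rewrite /lincomb big_nil.
- by move=> a b x M v; rewrite !lincomb_scale scalerA.
- by move=> x M v; rewrite !lincomb_scale scale1r.
- by move=> a x y M v; rewrite map_cat.
- by move=> a b x M v; rewrite lincomb_cat !lincomb_scale scalerDl.
by exists D, id, id; split.
Qed.

(** Freeness in the form in which it is used: finite expansions give finite
    supports, and linear extension defines maps on basis elements. *)
Definition free_on (I : eqType) F (e : I -> F) :=
  (forall x, exists s : seq I * (I -> R),
      uniq s.1 /\ x = \sum_(i <- s.1) s.2 i *: e i) /\
  (forall M (v : I -> M), exists g : {linear F -> M}, forall i, g (e i) = v i).

Lemma lincomb_collect (I : eqType) M (v : I -> M) s :
  lincomb v s =
  \sum_(i <- undup (map snd s)) (\sum_(p <- s | p.2 == i) p.1) *: v i.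
Proof.
under eq_bigr do rewrite scaler_suml.
rewrite (exchange_big_dep xpredT) //= /lincomb.
rewrite big_seq_cond [RHS]big_seq_cond; apply: eq_bigr => p.
rewrite andbT => ps; rewrite -big_filter.
have -> : [seq i <- undup [seq i.2 | i <- s] | p.2 == i] = [:: p.2].
  rewrite (eq_filter (a2 := pred1 p.2)); last first.
    by move=> i /=; rewrite eq_sym.
  by rewrite filter_pred1_uniq ?undup_uniq // mem_undup map_f.
by rewrite big_seq1.
Qed.

Lemma ex_free (I : eqType) : exists F (e : I -> F), free_on e.
Proof.
have [D [c [d [dK relE addE scaleE]]]] := free_premodule I.
pose F : lmodType R := classes D.
pose e i : F := class_of (c [:: (1, i)]).
have ext M (v : I -> M) :
    exists g : {linear F -> M}, forall x, g (class_of x) = lincomb v (d x).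
  pose g (q : F) := lincomb v (d (class_repr q)).
  have gE x : g (class_of x) = lincomb v (d x).
    by rewrite /g; move/relE: (class_reprP x); apply.
  have glin : linear g.
    move=> a p q; rewrite -(class_reprK p) -(class_reprK q) -class_ofZ.
    rewrite -class_ofD !gE addE scaleE !dK lincomb_cat lincomb_scale.
    by [].
  by exists (mklin glin) => x; rewrite mklinE gE.
have expand x : class_of x = lincomb e (d x) :> F.
  have [g gE] := ext F e; rewrite -gE.
  have gc s : g (class_of (c s)) = class_of (c s).
    rewrite gE dK; elim: s => [|[a i] s IHs].
      rewrite /lincomb big_nil -class_of0; apply/class_of_eq/relE => M v.
      have : pm_rel (pm_add (pm_zero D) (c [::])) (c [::]) by apply: pm_add0.
      move/relE => /(_ M v); rewrite addE !dK lincomb_cat => h.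
      apply/esym/(addIr (lincomb v [::])); rewrite h.
      by rewrite /lincomb big_nil addr0.
    rewrite /lincomb big_cons -/(lincomb e s) IHs -class_ofZ -class_ofD.
    by apply/class_of_eq/relE => M v; rewrite addE scaleE !dK /= mulr1.
  rewrite -[in RHS](_ : class_of (c (d x)) = class_of x) ?gc.
    by apply/class_of_eq/relE => M v; rewrite dK.
  by apply/class_of_eq/relE => M v; rewrite dK.
exists F, e; split=> [q|M v].
  rewrite -(class_reprK q) expand lincomb_collect.
  by eexists (_, _); split; last by []; apply: undup_uniq.
have [g gE] := ext M v; exists g => i.
by rewrite gE dK /lincomb big_seq1 scale1r.
Qed.

Lemma free_linear_eq (I : eqType) F (e : I -> F) M (g h : {linear F -> M}) :
  free_on e -> (forall i, g (e i) = h (e i)) -> forall x, g x = h x.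
Proof.
move=> [span _] gh x; have [s [_ ->]] := span x.
by rewrite !linear_sum; apply: eq_bigr => i _; rewrite !linearZ /= gh.
Qed.

Lemma free_projective (I : eqType) F (e : I -> F) :
  free_on e -> projective F.
Proof.
move=> eF A B g f /choice[s sK].
have [h hE] := eF.2 A (fun i => s (f (e i))).
exists h; apply: (free_linear_eq (g := lcomp g h) eF) => i.
by rewrite mklinE hE sK.
Qed.

(** The whole underlying set of [M] serves as a basis. *)
Lemma ex_free_cover M : exists F (e : M -> F) (q : {linear F -> M}),
  free_on e /\ surj q.
Proof.
have [F [e eF]] := ex_free M; have [q qE] := eF.2 M id.
by exists F, e, q; split=> // y; exists (e y).
Qed.

Lemma projective_retract P Q (i : {linear P -> Q}) (p : {linear Q -> P}) :
  (forall x, p (i x) = x) -> projective Q -> projective P.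
Proof.
move=> pi hQ A B g f gs; have [h hE] := hQ A B g (lcomp f p) gs.
by exists (lcomp h i) => x; rewrite !mklinE hE mklinE pi.
Qed.

Lemma projective_split P A (q : {linear A -> P}) :
  projective P -> surj q -> exists s : {linear P -> A}, forall x, q (s x) = x.
Proof. by move=> hP qs; have [s sK] := hP A P q (lid P) qs; exists s. Qed.

End Free.

(** * Enough injective modules *)

Section IntegerValued.
Implicit Types (A B : zmodType) (p q : rat).

(** Congruence modulo 1: the group Q/Z is handled through rational
    representatives. *)
Definition cong1 p q := p - q \is a Num.int.

Lemma cong1_refl p : cong1 p p.
Proof. by rewrite /cong1 subrr rpred0. Qed.

Lemma cong1_sym p q : cong1 p q -> cong1 q p.
Proof. by rewrite /cong1 => h; rewrite -opprB rpredN. Qed.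

Lemma cong1_trans p q r : cong1 p q -> cong1 q r -> cong1 p r.
Proof. by rewrite /cong1 => h1 h2; rewrite -(subrK q p) -addrA rpredD. Qed.

Lemma cong1D p p' q q' : cong1 p p' -> cong1 q q' -> cong1 (p + q) (p' + q').
Proof. by rewrite /cong1 => h1 h2; rewrite opprD addrACA rpredD. Qed.

Lemma cong1N p p' : cong1 p p' -> cong1 (- p) (- p').
Proof. by rewrite /cong1 => h; rewrite -opprD rpredN. Qed.

(** An additive map to the rationals modulo 1, through representatives. *)
Definition character A (f : A -> rat) := forall x y, cong1 (f (x + y)) (f x + f y).

(** The graph of a character defined on a subgroup, closed under integer
    translations of the values; single-valuedness is the last clause. *)
Definition partial_character A (H : A * rat -> Prop) :=
  [/\ forall x y p q, H (x, p) -> H (y, q) -> H (x - y, p - q),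
      forall q, q \is a Num.int -> H (0, q)
    & forall q, H (0, q) -> q \is a Num.int].

Lemma int_subgroup (P : int -> Prop) :
  (forall y z, P y -> P z -> P (y - z)) ->
  (forall z, P z -> z = 0) \/
  exists n : nat, [/\ (0 < n)%N, P n%:Z & forall z, P z -> exists k, z = k * n%:Z].
Proof.
move=> PB.
have P0 z : P z -> P 0 by move=> Pz; rewrite -(subrr z); apply: PB.
have PN z : P z -> P (- z).
  by move=> Pz; rewrite -sub0r; apply: PB => //; apply: P0 Pz.
have [ex|nex] := pselect (exists n : nat, `[< (0 < n)%N /\ P n%:Z >]); last first.
  left=> z Pz; apply: contrapT => z0; apply: nex; exists `|z|%N.
  apply/asboolP; split; first by rewrite absz_gt0; apply/eqP.
  by case: (intP z) Pz => // n Pz; rewrite ?abszN // -(opprK n.+1%:Z); apply: PN.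
right; case: (ex_minnP ex) => n /asboolP[n0 Pn] nmin; exists n; split=> // z Pz.
have Pk (k : int) : P (k * n%:Z).
  elim: k => [|k IHk|k IHk]; first by rewrite mul0r; apply: P0 Pz.
    rewrite -addn1 PoszD mulrDl mul1r -[n%:Z in X in _ + X]opprK.
    by apply: PB => //; apply: PN.
  by rewrite -addn1 PoszD opprD mulrDl mulN1r; apply: PB.
exists (z %/ n)%Z; rewrite {1}(divz_eq z n).
suff -> : (z %% n)%Z = 0 by rewrite addr0.
have Pr : P (z %% n)%Z.
  by rewrite -[(z %% n)%Z](addKr ((z %/ n)%Z * n)) -divz_eq addrC; apply: PB.
have n0' : n%:Z != 0 by rewrite -lt0n.
have r0 : 0 <= (z %% n)%Z by apply: modz_ge0.
have rn : (z %% n)%Z < n by rewrite ltz_pmod.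
case: (z %% n)%Z Pr r0 rn => // [[|r]] Pr _ rn //.
have : (n <= r.+1)%N by apply: nmin; apply/asboolP.
by rewrite leqNgt -ltz_nat rn.
Qed.

Lemma partial_character_mulz A (H : A * rat -> Prop) x p (k : int) :
  partial_character H -> H (x, p) -> H (x *~ k, p * k%:~R).
Proof.
move=> [HB H0 _] Hx.
have HN y q : H (y, q) -> H (- y, - q).
  by move=> Hy; rewrite -(sub0r y) -(sub0r q); apply: HB => //; apply: H0.
have HD y q y' q' : H (y, q) -> H (y', q') -> H (y + y', q + q').
  by move=> h /HN h'; rewrite -(opprK y') -(opprK q'); apply: HB.
elim: k => [|k IHk|k IHk]; first by rewrite mulr0z mulr0; apply: H0.
  by rewrite -addn1 PoszD mulrzDr intrD mulrDr mulr1z mulr1; apply: HD.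
rewrite -addn1 PoszD opprD mulrzDr intrD mulrDr mulrN1z mulrN1.
exact: HB.
Qed.

(** The value [c] at a new element [b] is admissible as soon as its multiples
    agree with the values already prescribed on the multiples of [b]. *)
Lemma partial_character_adjoin A (H : A * rat -> Prop) b c :
  partial_character H ->
  (forall (z : int) y, H (b *~ z, y) -> cong1 (c * z%:~R) y) ->
  partial_character (fun u => exists z : int, H (u.1 - b *~ z, u.2 - c * z%:~R)).
Proof.
move=> [HB H0 Hint] hc; split=> /=.
- move=> x y p q [z Hz] [w Hw]; exists (z - w).
  move: (HB _ _ _ _ Hz Hw); rewrite mulrzBr intrB mulrBr !opprB !addrA.
  have ac (V : zmodType) (s t u v : V) : s - t + u - v = s - v + u - t.
    by rewrite addrAC [s - t - v]addrAC addrAC.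
  by rewrite [x - _ + _ - _]ac [p - _ + _ - _]ac.
- by move=> q qi; exists 0; rewrite mulr0z mulr0 !subr0; apply: H0.
- move=> q [z]; rewrite sub0r => Hz.
  have h0 : H (0, 0) by apply: H0; apply: rpred0.
  have /hc : H (b *~ z, c * z%:~R - q).
    by have := HB _ _ _ _ h0 Hz; rewrite !sub0r opprK opprB.
  by rewrite /cong1 opprB addrC subrK.
Qed.

(** Injectivity of Q/Z: a maximal graph is total, since an admissible value at a
    missing element [b] is found by dividing by [n] the value at the least
    positive multiple [n b] in the domain. *)
Lemma character_extend A (H : A * rat -> Prop) : partial_character H ->
  exists g : A -> rat, character g /\ forall x q, H (x, q) -> cong1 (g x) q.
Proof.
move=> hH.
(* The empty graph is admitted only to give the empty chain an upper bound. *)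
pose P (G : A * rat -> Prop) := (forall u, ~ G u) \/
  partial_character G /\ (forall u, H u -> G u).
have [|G [PG Gmax]] := @Zorn_bigcup _ P.
  move=> F FP Ftot.
  have [[X [u [FX Xu]]]|none] := pselect (exists X u, F X /\ X u); last first.
    by left=> u [X FX Xu]; apply: none; exists X, u.
  have FG Y v : F Y -> Y v ->
      partial_character Y /\ (forall w, H w -> Y w).
    by move=> FY Yv; case: (FP _ FY) => // /(_ v).
  have [hX HX] := FG _ _ FX Xu; right; split; last first.
    by move=> v Hv; exists X => //; apply: HX.
  split=> [x y p q [Y FY Yx] [Z FZ Zy]|q qi|q [Y FY Yq]].
  - case: (Ftot _ _ FY FZ) => YZ.
      exists Z => //; have [[ZB _ _] _] := FG _ _ FZ Zy.
      by apply: ZB => //; apply: YZ.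
    exists Y => //; have [[YB _ _] _] := FG _ _ FY Yx.
    by apply: YB => //; apply: YZ.
  - by exists X => //; case: hX => _ h _; apply: h.
  - by have [[_ _ h] _] := FG _ _ FY Yq; apply: h.
have H0 : H (0, 0) by case: hH => _ h _; apply: h; apply: rpred0.
have [hG HG] : partial_character G /\ (forall u, H u -> G u).
  case: PG => // G0; exfalso; apply: (Gmax H); last by right.
  by split=> [u /G0 //|/(_ (0, 0) H0) /G0].
have total b : exists q, G (b, q).
  apply: contrapT => nb.
  have [GB G0 Gint] := hG.
  have [c hc] : exists c, forall (z : int) y,
      G (b *~ z, y) -> cong1 (c * z%:~R) y.
    have [||[n [n0 [y0 Gn] nz]]] := @int_subgroup (fun z => exists y, G (b *~ z, y)).
    - by move=> y z [p Gp] [q Gq]; exists (p - q); rewrite mulrzBr; apply: GB.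
    - move=> z0; exists 0 => z y Gz; have z_0 := z0 z (ex_intro _ y Gz).
      move: Gz; rewrite z_0 mulr0z mulr0 => /Gint yi.
      by rewrite /cong1 sub0r rpredN.
    exists (y0 / n%:R) => z y Gz.
    have [k zk] := nz z (ex_intro _ y Gz).
    have := GB _ _ _ _ (partial_character_mulz k hG Gn) Gz.
    rewrite -mulrzA zk [n%:Z * k]mulrC subrr => /Gint.
    rewrite /cong1; congr (_ - _ \is a _).
    by rewrite intrM mulrCA mulrC divfK // pnatr_eq0 -lt0n.
  have hG' := partial_character_adjoin hG hc.
  apply: (Gmax _ _ (or_intror (conj hG' _))); last first.
    by case=> x q /HG Gx; exists 0; rewrite mulr0z mulr0 !subr0.
  split=> [[x q] Gx|sub]; first by exists 0; rewrite mulr0z mulr0 !subr0.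
  apply: nb; exists c; apply: (sub (b, c)); exists 1.
  by rewrite mulr1z mulr1 !subrr; apply: G0; apply: rpred0.
have [g Gg] := choice total; have [GB _ Gint] := hG; exists g; split=> [x y|x q].
  rewrite /cong1 opprD addrA; apply: Gint.
  have -> : 0 = x + y - x - y by rewrite [x + y]addrC addrK subrr.
  by apply: (GB) => //; apply: (GB).
by move/HG => Gx; rewrite /cong1; apply: Gint; rewrite -(subrr x); apply: GB.
Qed.

(** On the cyclic group generated by [m] take a character sending [m] to 1/n,
    where [n] is the order of [m], or to 1/2 when the order is infinite. *)
Lemma character_separates A (m : A) : m != 0 ->
  exists g : A -> rat, character g /\ g m \isn't a Num.int.
Proof.
move=> m0.
have h0 : partial_character (fun u : A * rat => u.1 = 0 /\ u.2 \is a Num.int).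
  split=> /= [x y p q [-> pi] [-> qi]|q qi|q []] //.
  by rewrite subr0; split=> //; apply: rpredB.
have [c [ci hc]] : exists c : rat, c \isn't a Num.int /\
    forall z : int, m *~ z = 0 -> c * z%:~R \is a Num.int.
  have half (n : nat) : (1 < n)%N -> (n%:R : rat)^-1 \isn't a Num.int.
    move=> n1; apply/negP => /intrP[k nk].
    have n0 : (n%:R : rat) != 0 by rewrite pnatr_eq0 -lt0n ltnW.
    have : (n%:R : rat) * k%:~R = 1 by rewrite -nk divff.
    rewrite -[n%:R]/(n%:~R) -intrM -[1]/(1%:~R) => /intr_inj nk1.
    have : absz (n%:Z * k) = 1%N by rewrite nk1.
    rewrite abszM absz_nat => /eqP; rewrite muln_eq1 => /andP[/eqP n_1 _].
    by rewrite n_1 in n1.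
  have [||[n [n0 mn nz]]] := @int_subgroup (fun z => m *~ z = 0).
  - by move=> y z my mz; rewrite mulrzBr my mz subrr.
  - move=> z0; exists (2%:R)^-1; split; first exact: half.
    by move=> z /z0 ->; rewrite mulr0 rpred0.
  exists (n%:R)^-1; split.
    apply: half; rewrite ltn_neqAle n0 andbT eq_sym; apply/eqP => n1.
    by move: mn m0; rewrite n1 mulr1z => -> /eqP.
  move=> z /nz[k ->]; rewrite intrM mulrCA mulVf ?mulr1 ?pnatr_eq0 -?lt0n //.
have hc' (z : int) y : m *~ z = 0 /\ y \is a Num.int -> cong1 (c * z%:~R) y.
  by case=> /hc czi yi; rewrite /cong1 rpredB.
have [g [gc gP]] := character_extend (partial_character_adjoin h0 hc').
exists g; split=> //.
have : cong1 (g m) c.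
  by apply: gP; exists 1; rewrite /= mulr1z mulr1 !subrr; split=> //; apply: rpred0.
by rewrite /cong1 => gi; apply: contra ci => gmi; rewrite -(subKr (g m) c) rpredB.
Qed.

End IntegerValued.

Section Injectives.
Variable R : pzRingType.
Implicit Types A B C E F G J K M N P Q V W X Y Z : lmodType R.

Definition injective_module J := forall A B (i : {linear A -> B}) (f : {linear A -> J}),
  injective i -> exists g : {linear B -> J}, forall x, g (i x) = f x.

(** The additive maps from the ring to a power of Q/Z, with the action of the
    ring on the source; maps into this module are families of characters. *)
Lemma coinduced_premodule (I : Type) : exists D : premodule R,
  exists ev : pm_car D -> I -> R -> rat,
  [/\ forall u : I -> R -> rat, (forall i, character (u i)) ->
        exists x, ev x = u,
      forall x i, character (ev x i),
      forall x y, pm_rel x y <-> forall i r, cong1 (ev x i r) (ev y i r),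
      forall x y i r, ev (pm_add x y) i r = ev x i r + ev y i r &
      forall a x i r, ev (pm_scale a x) i r = ev x i (r * a)].
Proof.
have h0 (i : I) : character (fun _ : R => 0 : rat).
  by move=> r s; rewrite addr0; apply: cong1_refl.
pose T := {u : I -> R -> rat | forall i, character (u i)}.
have hN (u : T) (i : I) : character (fun r => - sval u i r).
  by move=> r s; rewrite -opprD; apply/cong1N/(svalP u).
have hD (u v : T) (i : I) : character (fun r => sval u i r + sval v i r).
  move=> r s; rewrite addrACA; apply: cong1D; first exact: (svalP u).
  exact: (svalP v).
have hZ a (u : T) (i : I) : character (fun r => sval u i (r * a)).
  by move=> r s; rewrite mulrDl; apply: (svalP u).
unshelve epose (D := @Premodule R T
  (fun u v => forall i r, cong1 (sval u i r) (sval v i r))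
  (exist _ _ h0) (fun u => exist _ _ (hN u)) (fun u v => exist _ _ (hD u v))
  (fun a u => exist _ _ (hZ a u)) _ _ _ _ _ _ _ _ _ _ _ _ _ _); simpl.
- by move=> u i r; apply: cong1_refl.
- by move=> u v h i r; apply: cong1_sym.
- by move=> u v w h1 h2 i r; apply: cong1_trans (h2 i r).
- by move=> u u' v v' h1 h2 i r; apply: cong1D.
- by move=> u u' h i r; apply: cong1N.
- by move=> a u u' h i r; apply: h.
- by move=> u v w i r; rewrite addrA; apply: cong1_refl.
- by move=> u v i r; rewrite addrC; apply: cong1_refl.
- by move=> u i r; rewrite add0r; apply: cong1_refl.
- by move=> u i r; rewrite addNr; apply: cong1_refl.
- by move=> a b u i r; rewrite mulrA; apply: cong1_refl.
- by move=> u i r; rewrite mulr1; apply: cong1_refl.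
- by move=> a u v i r; apply: cong1_refl.
- by move=> a b u i r; rewrite mulrDr; apply: (svalP u).
exists D, sval; split=> //; last by case.
by move=> u hF; exists (exist _ u hF).
Qed.

(** Indexing the power of Q/Z by all characters of [M] makes the evaluation map
    injective, because characters separate points. Injectivity of the coinduced
    module is the extension of characters, applied at each index. *)
Lemma enough_injectives M :
  exists J (m : {linear M -> J}), injective_module J /\ injective m.
Proof.
pose I := {chi : M -> rat | character chi}.
have [D [ev [mk evc relE addE scaleE]]] := coinduced_premodule I.
pose J : lmodType R := classes D.
have build N (c : N -> I -> R -> rat) :
    (forall x i, character (c x i)) ->
    (forall x y i r, cong1 (c (x + y) i r) (c x i r + c y i r)) ->
    (forall a x i r, cong1 (c (a *: x) i r) (c x i (r * a))) ->
    exists f : {linear N -> J}, forall x y,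
      (forall i r, cong1 (ev y i r) (c x i r)) -> f x = class_of y.
  move=> Fc FD FZ.
  have [f fE] := choice (fun x => mk (c x) (Fc x)).
  have flin : linear (fun x => class_of (f x) : J).
    move=> a x y; rewrite -class_ofZ -class_ofD.
    apply/class_of_eq/relE => i r; rewrite addE scaleE !fE.
    by apply: cong1_trans (FD _ _ _ _) _; apply: cong1D => //; apply: cong1_refl.
  exists (mklin flin) => x y h; rewrite mklinE; apply/class_of_eq/relE => i r.
  by rewrite fE; apply: cong1_sym.
pose Fm (x : M) (i : I) (r : R) := sval i (r *: x).
have [x i r s|x y i r|a x i r|m mE] := build M Fm.
- by rewrite /Fm scalerDl; apply: (svalP i).
- by rewrite /Fm scalerDr; apply: (svalP i).
- by rewrite /Fm scalerA; apply: cong1_refl.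
exists J, m; split; last first.
  apply: inj_ker0 => x mx0; apply: contrapT => /eqP /character_separates.
  case=> chi [chic /negP]; apply.
  have [y yE] : exists y, ev y = Fm x.
    by apply: mk => i r s; rewrite /Fm scalerDl; apply: (svalP i).
  have : class_of y = class_of (pm_zero D).
    by rewrite class_of0 -mx0; apply/esym/mE => i r; rewrite yE; apply: cong1_refl.
  move/class_of_eq/relE/(_ (exist _ chi chic) 1).
  have z0 : cong1 (ev (pm_zero D) (exist _ chi chic) 1) 0.
    have /relE/(_ (exist _ chi chic) 1) := pm_add0 (pm_zero D).
    by rewrite addE /cong1 addrK subr0.
  move/cong1_trans => /(_ _ z0).
  by rewrite yE /Fm /= scale1r /cong1 subr0.
move=> A B i f ii.
pose fr x := class_repr (f x).
have frD x y k r : cong1 (ev (fr (x + y)) k r) (ev (fr x) k r + ev (fr y) k r).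
  rewrite -addE; apply: (iffLR (relE _ _)); apply/class_of_eq.
  by rewrite class_ofD !class_reprK linearD.
have frZ a x k r : cong1 (ev (fr (a *: x)) k r) (ev (fr x) k (r * a)).
  rewrite -scaleE; apply: (iffLR (relE _ _)); apply/class_of_eq.
  by rewrite class_ofZ !class_reprK linearZ.
have ext k : exists g : B -> rat, character g /\
    forall x, cong1 (g (i x)) (ev (fr x) k 1).
  have fr0 : ev (fr 0) k 1 \is a Num.int.
    by have := frD 0 0 k 1; rewrite addr0 /cong1 opprD addrA subrr sub0r rpredN.
  have [|g [gc gE]] := @character_extend B
      (fun u => exists2 x, u.1 = i x & cong1 u.2 (ev (fr x) k 1)).
    split=> [_ _ p q /= [x -> hp] [y -> hq]|q qi|q /= [x ix0]].
    - exists (x - y); first by rewrite linearB.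
      have h := frD (x - y) y k 1; rewrite subrK in h.
      apply: (cong1_trans (cong1D hp (cong1N hq))).
      have := cong1D h (cong1_refl (- ev (fr y) k 1)).
      by rewrite addrK.
    - by exists 0; rewrite ?linear0 //= /cong1 rpredB.
    - have -> : x = 0 by apply: ii; rewrite -ix0 linear0.
      by rewrite /cong1 => h; rewrite -(subrK (ev (fr 0) k 1) q) rpredD.
  by exists g; split=> // x; apply: gE; exists x => //; apply: cong1_refl.
have [g gP] := choice ext.
have [b k r s|b c k r|a b k r|h hE] := build B (fun b k r => g k (r *: b)).
- by rewrite scalerDl; apply: (gP k).1.
- by rewrite scalerDr; apply: (gP k).1.
- by rewrite scalerA; apply: cong1_refl.
exists h => x; rewrite -(class_reprK (f x)); apply: hE => k r.
apply: cong1_sym; rewrite -linearZ; apply: cong1_trans ((gP k).2 _) _.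
by rewrite -[r in X in cong1 _ X]mul1r; apply: frZ.
Qed.

End Injectives.

(** * Vanishing of Ext, dimension shifting *)

Section Ext.
Variable R : pzRingType.
Implicit Types A B C D E F G J K L M N P Q S V W X Y Z : lmodType R.

(** The vanishing of Ext^1(X, M), stated for all extensions of [X] at once so that
    no resolution has to be chosen. *)
Definition ext1 X M := forall A B (i : {linear A -> B}) (p : {linear B -> X}),
  short_exact i p ->
  forall f : {linear A -> M}, exists g : {linear B -> M}, forall x, g (i x) = f x.

(** One projective presentation detects [ext1]: a second extension of [X] is a
    quotient of the direct sum of the presenting projective and its kernel. *)
Lemma ext1_presentation X M K P (k : {linear K -> P}) (q : {linear P -> X}) :
  projective P -> short_exact k q ->
  (forall f : {linear K -> M}, exists g : {linear P -> M}, forall x, g (k x) = f x) ->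
  ext1 X M.
Proof.
move=> hP [ki ke qs] hK A B i p [ii ie ps] f.
have [h hE] := hP _ _ p q ps.
have [u uE] : exists u : {linear K -> A}, forall x, i (u x) = h (k x).
  apply: (factor_ker (f := lcomp h k) ii ie) => x.
  by rewrite mklinE hE; apply: exact_comp0 ke.
have [e eE] := hK (lcomp f u).
pose s := ladd (lcomp h (lfst P A)) (lcomp i (lsnd P A)).
pose t := ladd (lcomp e (lfst P A)) (lcomp f (lsnd P A)).
have [||g gE] := @factor_surj _ _ _ _ s t.
- move=> b; have [x xE] := qs (p b).
  have /ie[a aE] : p (b - h x) = 0 by rewrite linearB hE xE subrr.
  by exists (x, a); rewrite !mklinE /= aE addrC subrK.
- move=> [x a]; rewrite !mklinE /= => h0.
  have /ke[y yE] : q x = 0.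
    by rewrite -hE -[h x](addrK (i a)) h0 sub0r linearN (exact_comp0 _ ie) oppr0.
  have -> : a = - u y.
    by apply: ii; rewrite linearN uE yE; apply/eqP; rewrite -addr_eq0 addrC h0.
  by rewrite -yE eE mklinE linearN subrr.
exists g => x; have := gE (0, x).
by rewrite !mklinE /= !linear0 !add0r.
Qed.

(** Pull the extension back along [f] and split it by extending the identity of
    [M]. *)
Lemma ext1_lift X M Y Z (i : {linear M -> Y}) (p : {linear Y -> Z})
    (f : {linear X -> Z}) :
  ext1 X M -> short_exact i p -> exists g : {linear X -> Y}, forall x, p (g x) = f x.
Proof.
move=> hX [ii ie ps].
pose c := lsub (lcomp p (lfst Y X)) (lcomp f (lsnd Y X)).
have [B [k [ki ke]]] := ex_ker c.
have kE b : p (k b).1 = f (k b).2.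
  by apply/eqP; rewrite -subr_eq0; apply/eqP/(exact_comp0 b ke).
have kex y x : p y = f x -> exists b, k b = (y, x).
  by move=> e; apply/ke; rewrite !mklinE /= e subrr.
have [j jE] : exists j : {linear M -> B}, forall m, k (j m) = (i m, 0).
  apply: (factor_inj (f := lpair i (lzero M X)) ki) => m.
  by apply: kex; rewrite (exact_comp0 _ ie) linear0.
pose q := lcomp (lsnd Y X) k.
have jq : short_exact j q.
  split=> [m m' e|b|x].
  - by apply: ii; move: (jE m); rewrite e jE => -[].
  - split=> [qb0|[m <-]]; last by rewrite !mklinE jE.
    have kb2 : (k b).2 = 0 := qb0.
    have /ie[m mE] : p (k b).1 = 0 by rewrite kE kb2 linear0.
    by exists m; apply: ki; rewrite jE mE -kb2; case: (k b).
  - have [y yE] := ps (f x); have [b bE] := kex _ _ yE.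
    by exists b; rewrite !mklinE bE.
have [r rE] := hX _ _ _ _ jq (lid M).
have [_ je qs] := jq.
have [|g gE] := factor_coker (f := lsub (lcomp (lfst Y X) k) (lcomp i r)) qs je.
  by move=> m; rewrite !mklinE rE jE mklinE /= subrr.
exists g => x; have [b <-] := qs x.
by rewrite gE !mklinE linearB (exact_comp0 _ ie) subr0 kE.
Qed.

(** The piece Hom(X, Y) -> Hom(X, Z) -> Ext^1(X, M) -> Ext^1(X, Y) of the long
    exact sequence. *)
Lemma ext1_of_lift X M Y Z (i : {linear M -> Y}) (p : {linear Y -> Z}) :
  ext1 X Y -> short_exact i p ->
  (forall f : {linear X -> Z}, exists g : {linear X -> Y}, forall x, p (g x) = f x) ->
  ext1 X M.
Proof.
move=> hX [ii ie ps] hl A B j q jq f; have [ji je qs] := jq.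
have [g gE] := hX _ _ _ _ jq (lcomp i f).
have [|h hE] := factor_coker (f := lcomp p g) qs je.
  by move=> x; rewrite mklinE gE mklinE (exact_comp0 _ ie).
have [h' h'E] := hl h.
have [|w wE] := factor_ker (f := lsub g (lcomp h' q)) ii ie.
  by move=> x; rewrite !mklinE linearB h'E hE mklinE subrr.
exists w => x; apply: ii; rewrite wE !mklinE gE mklinE.
by rewrite (exact_comp0 _ je) linear0 subr0.
Qed.

Lemma injective_ext1 X J : injective_module J -> ext1 X J.
Proof. by move=> hJ A B i p [ii _ _] f; apply: hJ. Qed.

(** Dimension shifting: Ext^1(X', A) = Ext^2(X, A) sits between Ext^1(X, C) and
    Ext^2(X, E) = Ext^1(X', E). *)
Lemma ext1_syzygy_of_quotient A E C X' P X (i : {linear A -> E}) (p : {linear E -> C})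
    (k : {linear X' -> P}) (q : {linear P -> X}) :
  short_exact i p -> short_exact k q -> projective P ->
  ext1 X' E -> ext1 X C -> ext1 X' A.
Proof.
move=> ip kq hP hE hC; apply: (ext1_of_lift hE ip) => f.
have [g gE] := hC _ _ _ _ kq f.
have [h hgE] := hP _ _ p g (let: And3 _ _ ps := ip in ps).
by exists (lcomp h k) => x; rewrite mklinE hgE gE.
Qed.

(** Ext^1(X, C) sits between Ext^1(X, E) and Ext^2(X, A) = Ext^1(X', A). *)
Lemma ext1_quotient_of_syzygy A E C X' P X (i : {linear A -> E}) (p : {linear E -> C})
    (k : {linear X' -> P}) (q : {linear P -> X}) :
  short_exact i p -> short_exact k q -> projective P ->
  ext1 X' A -> ext1 X E -> ext1 X C.
Proof.
move=> ip kq hP hA hE; apply: (ext1_presentation hP kq) => f.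
have [g gE] := ext1_lift f hA ip.
have [h hgE] := hE _ _ _ _ kq g.
by exists (lcomp p h) => x; rewrite mklinE hgE gE.
Qed.

(** Extend first to the kernel of [B -> X2], which is an extension of [X1]. *)
Lemma ext1_extension X1 X X2 V (i : {linear X1 -> X}) (p : {linear X -> X2}) :
  short_exact i p -> ext1 X1 V -> ext1 X2 V -> ext1 X V.
Proof.
move=> [ii ie ps] h1 h2 A B j q [ji je qs] f.
have pqs : surj (lcomp p q).
  by move=> z; have [x <-] := ps z; have [b <-] := qs x; exists b.
have [L [l [li le _]]] := ex_ker_ses pqs.
have [a aE] : exists a : {linear A -> L}, forall x, l (a x) = j x.
  apply: (factor_ker (f := j) li le) => x.
  by rewrite mklinE (exact_comp0 _ je) linear0.
have [b bE] : exists b : {linear L -> X1}, forall x, i (b x) = q (l x).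
  apply: (factor_ker (f := lcomp q l) ii ie) => x.
  exact: (exact_comp0 x le).
have ab : short_exact a b.
  split=> [x y e|y|x].
  - by apply: ji; rewrite -!aE e.
  - split=> [by0|[x <-]]; last by apply: ii; rewrite bE aE (exact_comp0 _ je) linear0.
    have /je[x xE] : q (l y) = 0 by rewrite -bE by0 linear0.
    by exists x; apply: li; rewrite aE.
  - have [y yE] := qs (i x).
    have /le[z zE] : lcomp p q y = 0 by rewrite mklinE yE (exact_comp0 _ ie).
    by exists z; apply: ii; rewrite bE zE.
have [g gE] := h1 _ _ _ _ ab f.
have [h hE] := h2 _ _ _ _ (And3 li le pqs) g.
by exists h => x; rewrite -aE hE gE.
Qed.

Lemma ext1_split X K P (k : {linear K -> P}) (q : {linear P -> X}) :
  ext1 X K -> short_exact k q -> exists s : {linear X -> P}, forall x, q (s x) = x.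
Proof. by move=> hX kq; have [s sE] := ext1_lift (lid X) hX kq; exists s. Qed.

Lemma linear_inverse A B (f : {linear A -> B}) : injective f -> surj f ->
  exists g : {linear B -> A}, (forall x, g (f x) = x) /\ (forall y, f (g y) = y).
Proof.
move=> fi fs; have [g gE] := factor_inj (f := lid B) fi fs.
by exists g; split=> [x|y]; [apply: fi|]; rewrite gE.
Qed.

Lemma ext1_isol X X' M (f : {linear X -> X'}) :
  injective f -> surj f -> ext1 X' M -> ext1 X M.
Proof.
move=> fi fs h A B i p [ii ie ps]; apply: (h _ _ i (lcomp f p)); split=> // [b|y].
  by rewrite mklinE -(linear0 f); split=> [/fi/ie|/ie ->].
by have [x <-] := fs y; have [b <-] := ps x; exists b.
Qed.

Lemma ext1_isor X M M' (f : {linear M -> M'}) :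
  injective f -> surj f -> ext1 X M -> ext1 X M'.
Proof.
move=> fi fs h A B i p ip u; have [g [gK fK]] := linear_inverse fi fs.
have [w wE] := h _ _ _ _ ip (lcomp g u).
by exists (lcomp f w) => x; rewrite mklinE wE mklinE fK.
Qed.

Record presentation X := Presentation {
  pr_ker : lmodType R;
  pr_mod : lmodType R;
  pr_in : {linear pr_ker -> pr_mod};
  pr_map : {linear pr_mod -> X};
  pr_projective : projective pr_mod;
  pr_exact : short_exact pr_in pr_map }.

Record copresentation X := Copresentation {
  co_mod : lmodType R;
  co_coker : lmodType R;
  co_in : {linear X -> co_mod};
  co_map : {linear co_mod -> co_coker};
  co_injective : injective_module co_mod;
  co_exact : short_exact co_in co_map }.

Lemma presentation_inhabited X : inhabited (presentation X).
Proof.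
have [P [e [q [eP qs]]]] := ex_free_cover X.
have [K [k kq]] := ex_ker_ses qs.
by constructor; apply: Presentation kq; apply: free_projective eP.
Qed.

Lemma copresentation_inhabited X : inhabited (copresentation X).
Proof.
have [J [i [hJ ii]]] := enough_injectives X.
have [C [p ip]] := ex_coker_ses ii.
by constructor; apply: Copresentation ip.
Qed.

Definition present X : presentation X := inhabited_witness (presentation_inhabited X).
Definition copresent X : copresentation X := inhabited_witness (copresentation_inhabited X).
Definition syz X := pr_ker (present X).
Definition cosyz X := co_coker (copresent X).

(** Both sides compute Ext^2(X, M). The right-hand side involves no resolution of
    [X], which is what makes [Ext_zero] independent of the resolution. *)
Lemma ext1_syz_cosyz X M : ext1 (syz X) M <-> ext1 X (cosyz M).
Proof.
have pX := pr_exact (present X); have cM := co_exact (copresent M).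
have hP := @pr_projective _ (present X); have hJ := @co_injective _ (copresent M).
split=> h.
  by apply: (ext1_quotient_of_syzygy cM pX hP h); apply: injective_ext1.
by apply: (ext1_syzygy_of_quotient cM pX hP _ h); apply: injective_ext1.
Qed.

Lemma ext1_iter_syz k X M : ext1 (iter k syz X) M <-> ext1 X (iter k cosyz M).
Proof.
elim: k M => [|k IHk] M //.
by rewrite [iter k.+1 cosyz M]iterSr -IHk -ext1_syz_cosyz.
Qed.

Lemma resolution_syzygy X (P : proj_resolution X) :
  exists K (k : {linear K -> res_obj P 0}) (u : {linear res_obj P 1 -> K}),
    [/\ short_exact k (res_aug P), forall x, k (u x) = res_d P 0 x,
        surj u & exact (res_d P 1) u].
Proof.
have [K [k kq]] := ex_ker_ses (@res_aug_surj _ _ P); have [ki ke qs] := kq.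
have [u uE] : exists u : {linear res_obj P 1 -> K}, forall x, k (u x) = res_d P 0 x.
  apply: (factor_ker (f := res_d P 0) ki ke) => x.
  exact: (exact_comp0 _ (@res_exact_aug _ _ P)).
have us : surj u.
  move=> y; have /(@res_exact_aug _ _ P)[x xE] := exact_comp0 y ke.
  by exists x; apply: ki; rewrite uE.
have ue : exact (res_d P 1) u.
  move=> x; rewrite -(@res_exact _ _ P 0 x) -uE.
  by rewrite (inj_eq0 _ ki).
by exists K, k, u.
Qed.

Lemma cohomology1 X (P : proj_resolution X) M :
  cohomology_zero P M 1 <-> ext1 X M.
Proof.
have [K [k [u [kq uE us ue]]]] := resolution_syzygy P.
split=> h.
  apply: (ext1_presentation (@res_projective _ _ P 0) kq) => f.
  have [|g gE] := h (lcomp f u).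
    by move=> x; rewrite mklinE (exact_comp0 _ ue) linear0.
  by exists g => x; have [y <-] := us x; rewrite uE -gE.
move=> f f0; have [f' f'E] := factor_coker us ue f0.
have [g gE] := h _ _ _ _ kq f'.
by exists g => x; rewrite -uE gE f'E.
Qed.

Lemma resolution_shift X (P : proj_resolution X) :
  exists X' (k : {linear X' -> res_obj P 0}) (P' : proj_resolution X'),
    short_exact k (res_aug P) /\
    forall M i, cohomology_zero P' M i.+1 <-> cohomology_zero P M i.+2.
Proof.
have [K [k [u [kq uE us ue]]]] := resolution_syzygy P.
exists K, k, (@ProjResolution _ K (fun i => res_obj P i.+1) (fun i => res_d P i.+1) u
  (fun i => @res_projective _ _ P i.+1) (fun i => @res_exact _ _ P i.+1) ue us).
by split.
Qed.

Lemma cohomology_cosyz k X (P : proj_resolution X) M :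
  cohomology_zero P M k.+1 <-> ext1 X (iter k cosyz M).
Proof.
elim: k X P => [|k IHk] X P; first exact: cohomology1.
have [X' [j [P' [jq P'E]]]] := resolution_shift P.
have cM := co_exact (copresent (iter k cosyz M)).
have hJ := @co_injective _ (copresent (iter k cosyz M)).
have hP := @res_projective _ _ P 0.
rewrite -P'E IHk; split=> h.
  by apply: (ext1_quotient_of_syzygy cM jq hP h); apply: injective_ext1.
by apply: (ext1_syzygy_of_quotient cM jq hP _ h); apply: injective_ext1.
Qed.

Lemma resolution_inhabited X : inhabited (proj_resolution X).
Proof.
pose pr i := present (iter i syz X).
pose d i : {linear pr_mod (pr i.+1) -> pr_mod (pr i)} :=
  lcomp (pr_in (pr i)) (pr_map (pr i.+1)).
have dE i : exact (d i) (pr_map (pr i)).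
  have [_ ie _] := pr_exact (pr i); have [_ _ ps] := pr_exact (pr i.+1) => y.
  split=> [/ie[x <-]|[x <-]]; last by rewrite mklinE (exact_comp0 _ ie).
  by have [z <-] := ps x; exists z.
constructor; apply: (@ProjResolution _ X _ d (pr_map (pr 0%N))) => //.
- by move=> i; apply: pr_projective.
- move=> i y; rewrite -(dE i.+1 y) mklinE; have [ii _ _] := pr_exact (pr i).
  by rewrite (inj_eq0 _ ii).
- by have [_ _] := pr_exact (pr 0%N).
Qed.

Lemma Ext_zero_cosyz k X M : Ext_zero k.+1 X M <-> ext1 X (iter k cosyz M).
Proof.
split=> [[P h]|h]; first by apply/(cohomology_cosyz _ P).
have [P] := resolution_inhabited X.
by exists P; apply/(cohomology_cosyz _ P).
Qed.

Lemma Ext_zero_syz k X M : Ext_zero k.+1 X M <-> ext1 (iter k syz X) M.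
Proof. by rewrite Ext_zero_cosyz ext1_iter_syz. Qed.

End Ext.

(** * Cellular embeddings into a right orthogonal class *)

Section Cells.
Variables (R : pzRingType) (I : Type) (S K F : I -> lmodType R).
Variables (k : forall i, {linear K i -> F i}) (q : forall i, {linear F i -> S i}).
Hypothesis F_projective : forall i, projective (F i).
Hypothesis kq_exact : forall i, short_exact (k i) (q i).
Variable M : lmodType R.

(** [t_sol i h x] is the value at [x] of a formal extension of [h] along [k i]. *)
Inductive term : Type :=
| t_in of M
| t_add of term & term
| t_scale of R & term
| t_sol i of (K i -> term) & F i.

(** The formal extension of [h] is subject to relations only when [h] is linear
    modulo the congruence itself. *)
Inductive teq : term -> term -> Prop :=
| teq_refl t : teq t t
| teq_sym s t : teq s t -> teq t s
| teq_trans s t u : teq s t -> teq t u -> teq s u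
| teq_add s s' t t' : teq s s' -> teq t t' -> teq (t_add s t) (t_add s' t')
| teq_scale a t t' : teq t t' -> teq (t_scale a t) (t_scale a t')
| teq_addA s t u : teq (t_add s (t_add t u)) (t_add (t_add s t) u)
| teq_addC s t : teq (t_add s t) (t_add t s)
| teq_add0 t : teq (t_add (t_in 0) t) t
| teq_addN t : teq (t_add (t_scale (-1) t) t) (t_in 0)
| teq_scaleA a b t : teq (t_scale a (t_scale b t)) (t_scale (a * b) t)
| teq_scale1 t : teq (t_scale 1 t) t
| teq_scaleDr a s t :
    teq (t_scale a (t_add s t)) (t_add (t_scale a s) (t_scale a t))
| teq_scaleDl a b t :
    teq (t_scale (a + b) t) (t_add (t_scale a t) (t_scale b t))
| teq_in a x y : teq (t_in (a *: x + y)) (t_add (t_scale a (t_in x)) (t_in y))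
| teq_sol_linear i h :
    (forall a x y, teq (h (a *: x + y)) (t_add (t_scale a (h x)) (h y))) ->
    forall a x y, teq (t_sol (i := i) h (a *: x + y))
                      (t_add (t_scale a (t_sol h x)) (t_sol h y))
| teq_sol_extends i h :
    (forall a x y, teq (h (a *: x + y)) (t_add (t_scale a (h x)) (h y))) ->
    forall y, teq (t_sol (i := i) h (k i y)) (h y).

Definition term_premodule : premodule R :=
  @Premodule R term teq (t_in 0) (t_scale (-1)) t_add t_scale
    teq_refl teq_sym teq_trans teq_add (@teq_scale (-1)) teq_scale
    teq_addA teq_addC teq_add0 teq_addN teq_scaleA teq_scale1
    teq_scaleDr teq_scaleDl.

Definition cell_module : lmodType R := classes term_premodule.
Definition tcl (t : term) : cell_module := class_of (D := term_premodule) t.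

Lemma tcl_eq s t : tcl s = tcl t <-> teq s t.
Proof. exact: class_of_eq. Qed.

Lemma tclP a s t : tcl (t_add (t_scale a s) t) = a *: tcl s + tcl t.
Proof.
by rewrite /tcl -(class_ofZ (D := term_premodule)) -(class_ofD (D := term_premodule)).
Qed.

Lemma cell_in_linear : linear (fun x => tcl (t_in x)).
Proof. by move=> a x y; rewrite -tclP; apply/tcl_eq/teq_in. Qed.

Definition cell_in : {linear M -> cell_module} := mklin cell_in_linear.

Definition tlinear i (h : K i -> term) :=
  forall a x y, teq (h (a *: x + y)) (t_add (t_scale a (h x)) (h y)).

Lemma cell_sol_linear i (h : K i -> term) :
  tlinear h -> linear (fun x => tcl (t_sol h x)).
Proof. by move=> hl a x y; rewrite -tclP; apply/tcl_eq/teq_sol_linear. Qed.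

(** A map from [K i] lifts to expressions, and the formal extension of the lift
    is the extension sought. *)
Lemma cell_module_orthogonal i : ext1 (S i) cell_module.
Proof.
apply: (ext1_presentation (@F_projective i) (kq_exact i)) => f.
pose h y : term := class_repr (f y).
have hE y : tcl (h y) = f y by apply: class_reprK.
have hl : tlinear h by move=> a x y; apply/tcl_eq; rewrite tclP !hE linearP.
exists (mklin (cell_sol_linear hl)) => y.
by rewrite mklinE -hE; apply/tcl_eq/teq_sol_extends.
Qed.

Section Interpretation.
Variables (V Y B : lmodType R) (v : {linear V -> Y}) (b : {linear Y -> B}).
Hypothesis vb : short_exact v b.
Hypothesis V_orthogonal : forall i, ext1 (S i) V.
Variables (c : {linear cell_module -> B}) (j : {linear M -> Y}).
Hypothesis bj : forall x, b (j x) = c (cell_in x).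

Definition good_solution i (h : K i -> term) (g : K i -> Y) (e : {linear F i -> Y}) :=
  (forall y, e (k i y) = g y) /\ (forall x, b (e x) = c (tcl (t_sol h x))).

Definition any_lift (z : B) : Y :=
  sval (cid (let: And3 _ _ bs := vb in bs z)).

(** Recursion on expressions has to give a value even to formal extensions of
    maps that are not linear; any lift of the prescribed image will do there. *)
Definition solution i (h : K i -> term) (g : K i -> Y) (x : F i) : Y :=
  if pselect (exists e, good_solution h g e) is left ex then sval (cid ex) x
  else any_lift (c (tcl (t_sol h x))).

Fixpoint interp (t : term) : Y :=
  match t with
  | t_in x => j x
  | t_add s t => interp s + interp t
  | t_scale a t => a *: interp t
  | t_sol i h x => solution h (fun y => interp (h y)) x
  end.

Lemma interp_lifts t : b (interp t) = c (tcl t).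
Proof.
elim: t => [x|s IHs t IHt|a t IHt|i h IHh x] /=.
- exact: bj.
- rewrite linearD IHs IHt -linearD /tcl.
  by rewrite -(class_ofD (D := term_premodule)).
- rewrite linearZ /= IHt -linearZ /tcl.
  by rewrite -(class_ofZ (D := term_premodule)).
- rewrite /solution; case: pselect => [ex|_].
    by case: (cid ex) => e [_ eE] /=.
  by rewrite /any_lift; case: cid.
Qed.

(** Projectivity of [F i] lifts the formal extension to [Y]; orthogonality of
    [V] corrects the lift on [K i]. *)
Lemma good_solution_exists i (h : K i -> term) :
  tlinear h -> linear (fun y => interp (h y)) ->
  exists e, good_solution h (fun y => interp (h y)) e.
Proof.
move=> hl gl; have [vi ve bs] := vb.
pose u := mklin (cell_sol_linear hl).
have [l lE] := F_projective (lcomp c u) bs.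
have [|w wE] := factor_ker (f := lsub (lcomp l (k i)) (mklin gl)) vi ve.
  move=> y; rewrite !mklinE linearB lE !mklinE interp_lifts.
  by rewrite (iffRL (tcl_eq _ _) (teq_sol_extends hl y)) subrr.
have [w' w'E] := V_orthogonal (kq_exact i) w.
exists (lsub l (lcomp v w')); split=> [y|x].
  by rewrite !mklinE w'E wE !mklinE subKr.
by rewrite !mklinE linearB lE (exact_comp0 _ ve) subr0.
Qed.

Lemma solution_good i (h : K i -> term) :
  tlinear h -> linear (fun y => interp (h y)) ->
  exists2 e, good_solution h (fun y => interp (h y)) e &
             forall x, interp (t_sol h x) = e x.
Proof.
move=> hl gl; rewrite /= /solution; case: pselect => [ex|nex]; last first.
  by case: nex; apply: good_solution_exists.
by exists (sval (cid ex)) => //; apply: svalP.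
Qed.

Lemma interp_teq s t : teq s t -> interp s = interp t.
Proof.
elim=> {s t} //=.
- by move=> s t u _ -> _ ->.
- by move=> s s' t t' _ -> _ ->.
- by move=> a t t' _ ->.
- by move=> s t u; rewrite addrA.
- by move=> s t; rewrite addrC.
- by move=> t; rewrite linear0 add0r.
- by move=> t; rewrite scaleN1r addNr linear0.
- by move=> a a' t; rewrite scalerA.
- by move=> t; rewrite scale1r.
- by move=> a s t; rewrite scalerDr.
- by move=> a a' t; rewrite scalerDl.
- by move=> a x y; rewrite linearP.
- move=> i h hl gl a x y; have [e [_ _] eE] := solution_good hl gl.
  by move: (eE (a *: x + y)) (eE x) (eE y) => /= -> -> ->; rewrite linearP.
- move=> i h hl gl y; have [e [eK _] eE] := solution_good hl gl.
  by move: (eE (k i y)) => /= ->; rewrite eK.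
Qed.

(** The embedding of [M] has the left lifting property against the surjections
    with kernel in the right orthogonal class; injectivity of the embedding and
    orthogonality of its cokernel are two instances of this. *)
Lemma cell_lift : exists f : {linear cell_module -> Y},
  (forall z, b (f z) = c z) /\ (forall x, f (cell_in x) = j x).
Proof.
pose f (z : cell_module) := interp (class_repr z).
have fE t : f (tcl t) = interp t.
  by apply: interp_teq; apply: (class_reprP (D := term_premodule)).
have flin : linear f.
  by move=> a x y; rewrite -(class_reprK x) -(class_reprK y) -tclP !fE.
exists (mklin flin); split=> [z|x]; last by rewrite !mklinE fE.
by rewrite mklinE -[in RHS](class_reprK z) interp_lifts.
Qed.

End Interpretation.

(** Extend an embedding of [M] in an injective module [J], by lifting against the
    map from [J] to zero. *)
Lemma cell_in_injective : injective cell_in.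
Proof.
have [J [m [hJ mi]]] := enough_injectives M.
have [|Q [p [ps pN]]] := @ex_quot R J (fun _ => True); first by split.
have lp : short_exact (lid J) p.
  by split=> // y; split=> [_|[x _]]; [exists y|apply/pN].
have hJS i : ext1 (S i) J by apply: injective_ext1.
have m0 x : p (m x) = lzero cell_module Q (cell_in x) by apply/pN.
have [f [_ fE]] := cell_lift lp hJS m0.
by move=> x y e; apply: mi; rewrite -!fE e.
Qed.

(** Embed [V] in an injective module [D] with cokernel [E]: a map from [C] to [E]
    lifts to [D] on the cell module, by zero on [M], hence on [C]. *)
Lemma cell_cokernel_orthogonal (C V : lmodType R) (p : {linear cell_module -> C}) :
  exact cell_in p -> surj p -> (forall i, ext1 (S i) V) -> ext1 C V.
Proof.
move=> pe ps hV; have [D E v b hD vb] := copresent V.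
have hCD : ext1 C D by apply: injective_ext1.
apply: (ext1_of_lift hCD vb) => f.
have h0 x : b (lzero M D x) = lcomp f p (cell_in x).
  by rewrite !mklinE (exact_comp0 _ pe) !linear0.
have [g [gb g0]] := cell_lift vb hV h0.
have [//|h hE] := factor_coker (f := g) ps pe.
exists h => z; have [x <-] := ps z.
by rewrite hE gb.
Qed.

End Cells.

(** One half of the completeness of the cotorsion pair generated by a small family:
    the cell module for projective presentations of the [S i]. *)
Lemma special_embedding (R : pzRingType) (I : Type) (S : I -> lmodType R)
    (M : lmodType R) : exists (W C : lmodType R) (m : {linear M -> W}) (p : {linear W -> C}),
    [/\ short_exact m p, forall i, ext1 (S i) W &
        forall V, (forall i, ext1 (S i) V) -> ext1 C V].
Proof.
pose k i := pr_in (present (S i)); pose q i := pr_map (present (S i)).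
have hF i : projective (pr_mod (present (S i))) by apply: pr_projective.
have kq i : short_exact (k i) (q i) by apply: pr_exact.
have mi := @cell_in_injective _ _ _ _ _ _ _ hF kq M.
have [C [p mp]] := ex_coker_ses mi.
exists (cell_module k M), C, (cell_in k M), p; split=> // [i|V hV].
  exact: cell_module_orthogonal.
have [_ pe ps] := mp.
exact: (cell_cokernel_orthogonal hF kq pe ps hV).
Qed.

(** * Complexes of projectives and pure exact complexes *)

Section FreeComplex.
Variables (R : pzRingType) (I : nat -> eqType) (F X : nat -> lmodType R).
Variables (e : forall j, I j -> F j) (d : forall j, {linear F j -> F j.+1}).
Variable delta : forall j, {linear X j -> X j.+1}.
Hypothesis eF : forall j, free_on (@e j).
Hypothesis dd : forall j x, d j.+1 (d j x) = 0.
Hypothesis deltadelta : forall j x, delta j.+1 (delta j x) = 0.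

(** The exactness of Hom(D, X) in positive degrees for finitely presented [D],
    spelled out for generators of [D] and the matrix [r] of their relations. *)
Definition pure_lifting := forall j m p (r : 'I_p -> 'I_m -> R) (z : 'I_m -> X j.+1),
  (forall i, delta j.+1 (z i) = 0) -> (forall k, \sum_i r k i *: z i = 0) ->
  exists y : 'I_m -> X j,
    (forall i, delta j (y i) = z i) /\ (forall k, \sum_i r k i *: y i = 0).
Hypothesis pureX : pure_lifting.

Definition expansion j (x : F j) : seq (I j) * (I j -> R) :=
  sval (cid ((eF j).1 x)).
Definition supp j (x : F j) := (expansion x).1.
Definition coef j (x : F j) := (expansion x).2.

Lemma supp_uniq j (x : F j) : uniq (supp x).
Proof. by rewrite /supp /expansion; case: cid => s []. Qed.

Lemma expansionE j (x : F j) : x = \sum_(i <- supp x) coef x i *: e i.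
Proof. by rewrite /supp /coef /expansion; case: cid => s []. Qed.

Lemma eq_on_supp j (Y : lmodType R) (g h : {linear F j -> Y}) x :
  (forall c, c \in supp x -> g (e c) = h (e c)) -> g x = h x.
Proof.
move=> gh; rewrite (expansionE x) !linear_sum.
by apply: eq_big_seq => c /gh ghc; rewrite !linearZ /= ghc.
Qed.

(** On a finite set [N j] of new basis elements in each degree, modulo the
    span of [dom], the complex consists of finitely generated free modules,
    and its boundaries are given by finitely many relations. *)
Section FiniteStep.
Variables (dom : forall j, I j -> Prop) (N : forall j, seq (I j)).
Arguments dom {j}.
Hypothesis dom_closed :
  forall j (b : I j), dom b -> forall c, c \in supp (d j (e b)) -> dom c.
Hypothesis N_uniq : forall j, uniq (N j).
Hypothesis N_disj : forall j (b : I j), b \in N j -> ~ dom b.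
Hypothesis N_closed : forall j (b : I j), b \in N j ->
  forall c, c \in supp (d j (e b)) -> dom c \/ c \in N j.+1.

Lemma sum_on_N j (Y : lmodType R) (g : {linear F j -> Y}) x :
  (forall c, c \in supp x -> dom c \/ c \in N j) ->
  (forall c, dom c -> g (e c) = 0) ->
  g x = \sum_(i < size (N j))
    (if tnth (in_tuple (N j)) i \in supp x then coef x (tnth (in_tuple (N j)) i)
     else 0) *: g (e (tnth (in_tuple (N j)) i)).
Proof.
move=> xK g0.
rewrite -(big_tnth _ _ (N j) xpredT
  (fun c => (if c \in supp x then coef x c else 0) *: g (e c))) /=.
rewrite {1}(expansionE x) linear_sum.
transitivity (\sum_(c <- supp x | c \in N j) coef x c *: g (e c)).
  rewrite [RHS]big_mkcond; apply: eq_big_seq => c cx; rewrite linearZ /=.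
  by case: ifP => // cN; case: (xK c cx) => [/g0->|]; rewrite ?scaler0 ?cN.
transitivity (\sum_(c <- N j | c \in supp x) coef x c *: g (e c)); last first.
  rewrite [LHS]big_mkcond; apply: eq_bigr => c _.
  by case: ifP => //; rewrite scale0r.
rewrite -big_filter -[RHS]big_filter; apply: perm_big.
apply: uniq_perm; rewrite ?filter_uniq ?supp_uniq // => c.
by rewrite !mem_filter andbC.
Qed.

(** Purity in terms of maps: the finitely many values of [z] on new basis elements
    are lifted along the differential of [X], keeping the relations in [U]. *)
Lemma finite_lift j k (z : {linear F j -> X k.+1}) (U : seq (F j)) :
  (forall b, b \in N j -> delta k.+1 (z (e b)) = 0) ->
  (forall b, dom b -> z (e b) = 0) ->
  (forall u, u \in U -> z u = 0) ->
  (forall u, u \in U -> forall c, c \in supp u -> dom c \/ c \in N j) ->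
  exists y : {linear F j -> X k},
    [/\ forall b, b \in N j -> delta k (y (e b)) = z (e b),
        forall b, b \notin N j -> y (e b) = 0 &
        forall u, u \in U -> y u = 0].
Proof.
move=> dz z0 zU UK.
pose n i := tnth (in_tuple (N j)) i; pose u i := tnth (in_tuple U) i.
have nN i : n i \in N j by apply: mem_tnth.
have uU i : u i \in U by apply: mem_tnth.
have [i|i|y [yz yu]] := @pureX k _ _
    (fun (a : 'I_(size U)) (i : 'I_(size (N j))) =>
       if n i \in supp (u a) then coef (u a) (n i) else 0)
    (fun i => z (e (n i))).
- exact: dz.
- by rewrite -(sum_on_N (UK _ (uU i)) z0) zU.
have [g gE] := (eF j).2 _ (fun b => \sum_(i | n i == b) y i).
have gn i : g (e (n i)) = y i.
  rewrite gE (big_pred1 i) // => i' /=.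
  exact: (inj_eq (elimT (tuple_uniqP (in_tuple (N j))) (N_uniq j))).
have gN b : b \notin N j -> g (e b) = 0.
  by move=> bN; rewrite gE big_pred0 // => i; apply: contraNF bN => /eqP <-.
exists g; split=> // [b|w].
  by case/(tnthP (in_tuple (N j))) => i ->; rewrite -/(n i) gn yz.
case/(tnthP (in_tuple U)) => i ->; rewrite -/(u i).
rewrite (sum_on_N (UK _ (uU i))); last by move=> c cd; apply/gN/negP => /N_disj.
by rewrite -[RHS](yu i); apply: eq_bigr => i' _; rewrite gn.
Qed.

Definition boundaries j : seq (F j) :=
  match j with
  | 0%N => [::]
  | i.+1 => [seq d i (e b) | b <- N i]
  end.

Lemma boundaries_supp j u : u \in boundaries j ->
  forall c, c \in supp u -> dom c \/ c \in N j.
Proof.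
by case: j u => [|j] u //= /mapP[b bN ->]; apply: N_closed.
Qed.

Lemma boundaries_cycle j u : u \in boundaries j -> d j u = 0.
Proof. by case: j u => [|j] u //= /mapP[b bN ->]; apply: dd. Qed.

Lemma boundaries_mem j b : b \in N j -> d j (e b) \in boundaries j.+1.
Proof. by move=> bN; apply/mapP; exists b. Qed.

Lemma eq_on_N j (Y : lmodType R) (g h : {linear F j.+1 -> Y}) b :
  (forall c, dom c -> g (e c) = h (e c)) ->
  (forall c, c \in N j.+1 -> g (e c) = h (e c)) ->
  b \in N j -> g (d j (e b)) = h (d j (e b)).
Proof.
move=> hd hN bN; apply: eq_on_supp => c cb.
by case: (N_closed bN cb) => [/hd|/hN].
Qed.

Lemma zero_on_dom j (Y : lmodType R) (g : {linear F j.+1 -> Y}) b :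
  (forall c, dom c -> g (e c) = 0) -> dom b -> g (d j (e b)) = 0.
Proof.
move=> hd bd; rewrite -[RHS](_ : lzero _ _ (d j (e b)) = 0) //.
by apply: eq_on_supp => c /(dom_closed bd)/hd.
Qed.

Variable psi : forall j, {linear F j -> X j.+1}.
Hypothesis psi_chain : forall j x, psi j.+1 (d j x) = delta j.+1 (psi j x).
Hypothesis psi_dom : forall j (b : I j), dom b -> psi j (e b) = 0.

(** The homotopy is obtained from three lifts, each of which either starts from
    finitely many free generators or vanishes on boundaries, hence starts from a
    finitely presented cokernel: [tau] lifts [psi d] and vanishes on boundaries,
    [a] lifts the remaining cycle [psi - tau], and [rho] lifts the defect
    [tau - a d], again vanishing on boundaries. Then [a + rho] is a homotopy. *)
Lemma finite_null_homotopy : exists s : forall j, {linear F j -> X j},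
  (forall j (b : I j), dom b -> s j (e b) = 0) /\
  (forall j (b : I j), b \in N j ->
     psi j (e b) = delta j (s j (e b)) + s j.+1 (d j (e b))).
Proof.
have offN j (Y : lmodType R) (g : {linear F j -> Y}) :
    (forall b, b \notin N j -> g (e b) = 0) -> forall b, dom b -> g (e b) = 0.
  by move=> h b bd; apply: h; apply/negP => /N_disj.
have /dependent_choice[tau tauP] : forall j, exists t : {linear F j -> X j.+1},
    [/\ forall b, b \in N j -> delta j.+1 (t (e b)) = psi j.+1 (d j (e b)),
        forall b, b \notin N j -> t (e b) = 0 &
        forall u, u \in boundaries j -> t u = 0].
  move=> j; apply: (@finite_lift j j.+1 (lcomp (psi j.+1) (d j))).
  - by move=> b _; rewrite mklinE -psi_chain dd linear0.
  - by move=> b bd; rewrite mklinE (zero_on_dom (@psi_dom _)).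
  - by move=> u uU; rewrite mklinE (boundaries_cycle uU) linear0.
  - exact: boundaries_supp.
have /dependent_choice[a aP] : forall j, exists a : {linear F j -> X j},
    [/\ forall b, b \in N j -> delta j (a (e b)) = psi j (e b) - tau j (e b),
        forall b, b \notin N j -> a (e b) = 0 &
        forall u, u \in [::] -> a u = 0].
  move=> j; have [t1 t0 tU] := tauP j.
  apply: (@finite_lift j j (lsub (psi j) (tau j))) => //.
  - by move=> b bN; rewrite mklinE linearB t1 // psi_chain subrr.
  - by move=> b bd; rewrite mklinE psi_dom // (offN _ _ _ t0) // subrr.
have da j b : b \in N j ->
    delta j.+1 (a j.+1 (d j (e b))) = psi j.+1 (d j (e b)).
  move=> bN; have [t1 t0 tU] := tauP j.+1; have [a1 a0 _] := aP j.+1.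
  transitivity (psi j.+1 (d j (e b)) - tau j.+1 (d j (e b))).
    apply: (eq_on_N (g := lcomp (delta j.+1) (a j.+1))
                    (h := lsub (psi j.+1) (tau j.+1))) => // c cd.
    by rewrite !mklinE psi_dom // !(offN _ _ _ _ _ cd) // subrr linear0.
  by rewrite tU ?subr0 // boundaries_mem.
have /dependent_choice[rho rhoP] : forall j, exists r : {linear F j -> X j},
    [/\ forall b, b \in N j ->
          delta j (r (e b)) = tau j (e b) - a j.+1 (d j (e b)),
        forall b, b \notin N j -> r (e b) = 0 &
        forall u, u \in boundaries j -> r u = 0].
  move=> j; have [t1 t0 tU] := tauP j; have [a1 a0 _] := aP j.+1.
  apply: (@finite_lift j j (lsub (tau j) (lcomp (a j.+1) (d j)))).
  - by move=> b bN; rewrite !mklinE linearB t1 // da // subrr.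
  - move=> b bd; rewrite !mklinE (zero_on_dom (offN _ _ _ a0)) // subr0.
    exact: (offN _ _ _ t0).
  - by move=> u uU; rewrite !mklinE tU // (boundaries_cycle uU) linear0 subrr.
  - exact: boundaries_supp.
exists (fun j => ladd (a j) (rho j)); split=> j b bN.
  have [_ a0 _] := aP j; have [_ r0 _] := rhoP j.
  by rewrite mklinE !(offN _ _ _ _ _ bN) // addr0.
have [a1 _ _] := aP j; have [r1 _ _] := rhoP j; have [_ _ rU] := rhoP j.+1.
rewrite !mklinE linearD a1 // r1 // (rU (d j (e b))) ?boundaries_mem // addr0.
by rewrite addrA subrK subrK.
Qed.

End FiniteStep.

Section Maximality.
Variable phi : forall j, {linear F j -> X j.+1}.
Hypothesis phi_chain : forall j x, phi j.+1 (d j x) = delta j.+1 (phi j x).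

Definition graph := {j : nat & (I j * X j)%type} -> Prop.
Definition at_graph (H : graph) j b v := H (existT _ j (b, v)).
Definition graph_dom (H : graph) j b := exists v, @at_graph H j b v.

(** The graph of a null homotopy on a subcomplex spanned by basis elements.
    The equation at [b] is witnessed by some linear map agreeing with the graph
    on the support of the boundary of [b], which makes it stable under unions. *)
Definition partial_homotopy (H : graph) :=
  (forall j b v w, @at_graph H j b v -> at_graph H b w -> v = w) /\
  (forall j b v, @at_graph H j b v -> exists s : {linear F j.+1 -> X j.+1},
     (forall c, c \in supp (d j (e b)) -> at_graph H c (s (e c))) /\
     phi j (e b) = delta j v + s (d j (e b))).

Lemma maximal_partial_homotopy : exists H,
  partial_homotopy H /\
  forall G, partial_homotopy G -> (forall t, H t -> G t) -> forall t, G t -> H t.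
Proof.
have [|H [HP Hmax]] := @Zorn_bigcup _ partial_homotopy; last first.
  exists H; split=> // G GP HG t Gt; apply: contrapT => nHt.
  by apply: (Hmax G) => //; split=> // /(_ t Gt).
move=> Fam FamP tot; split=> [j b v w [G FG Gv] [G' FG' G'w]|j b v [G FG Gv]].
  case: (tot _ _ FG FG') => sub.
    by have [fn _] := FamP _ FG'; apply: fn G'w; apply: sub.
  by have [fn _] := FamP _ FG; apply: fn Gv _; apply: sub.
have [_ /(_ _ _ _ Gv)[s [sG sE]]] := FamP _ FG.
by exists s; split=> // c /sG cG; exists G.
Qed.

(** Each basis element has a boundary of finite support, so that closing finitely
    many elements per degree under supports keeps every degree finite. *)
Fixpoint closure (s0 : forall j, seq (I j)) j : seq (I j) :=
  match j with
  | 0%N => s0 0%N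
  | i.+1 => s0 i.+1 ++ flatten [seq supp (d i (e b)) | b <- closure s0 i]
  end.

Lemma closure_start s0 j b : b \in s0 j -> b \in closure s0 j.
Proof. by case: j b => [|j] b //= h; rewrite mem_cat h. Qed.

Lemma closure_supp s0 j b c :
  b \in closure s0 j -> c \in supp (d j (e b)) -> c \in closure s0 j.+1.
Proof.
move=> bs cb /=; rewrite mem_cat; apply/orP; right.
by apply/flattenP; exists (supp (d j (e b))) => //; apply: map_f.
Qed.

(** If the domain of a maximal homotopy misses a basis element, the closure of
    some missing elements is a finite step over it, and the homotopy extends. *)
Lemma maximal_total H : partial_homotopy H ->
  (forall G, partial_homotopy G -> (forall t, H t -> G t) -> forall t, G t -> H t) ->
  forall j b, @graph_dom H j b.
Proof.
move=> [Hfun HE] Hmax.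
have /dependent_choice[sH sHE] : forall j, exists s : {linear F j -> X j},
    forall b v, at_graph H b v -> s (e b) = v.
  move=> j; pose v b := if pselect (@graph_dom H j b) is left h
                        then sval (cid h) else 0.
  have [g gE] := (eF j).2 _ v; exists g => b w Hw.
  rewrite gE /v; case: pselect => [h|[]]; last by exists w.
  by apply: Hfun Hw; apply: (svalP (cid h)).
pose dom := @graph_dom H.
have dom_closed j (b : I j) : dom j b ->
    forall c, c \in supp (d j (e b)) -> dom j.+1 c.
  by move=> [v /HE[s [sG _]]] c /sG; exists (s (e c)).
have sH_dom j (b : I j) : dom j b ->
    phi j (e b) = delta j (sH j (e b)) + sH j.+1 (d j (e b)).
  move=> [v Hv]; rewrite (sHE _ _ _ Hv); have [s [sG ->]] := HE _ _ _ Hv.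
  by congr (_ + _); apply: eq_on_supp => c /sG/sHE ->.
(* The defect of the present homotopy, to be killed on new elements. *)
pose psi j := lsub (lsub (phi j) (lcomp (delta j) (sH j))) (lcomp (sH j.+1) (d j)).
have psi_chain j x : psi j.+1 (d j x) = delta j.+1 (psi j x).
  rewrite !mklinE dd linear0 subr0 phi_chain !linearB deltadelta subr0.
  by [].
have psi_dom j (b : I j) : dom j b -> psi j (e b) = 0.
  by move=> /sH_dom bE; rewrite !mklinE bE addrAC addrK subrr.
apply: contrapT => /existsNP[j0] /existsNP[b0 nb0].
(* One new basis element in each degree where one is left, so that no degree
   has to be singled out. *)
pose s0 j := if pselect (exists b, ~ dom j b) is left h
             then [:: sval (cid h)] else [::].
pose L := closure s0.
pose N j := undup [seq b <- L j | ~~ `[< dom j b >]].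
have N_uniq j : uniq (N j) by apply: undup_uniq.
have N_disj j (b : I j) : b \in N j -> ~ dom j b.
  by rewrite mem_undup mem_filter => /andP[/asboolPn].
have LN j (b : I j) : b \in L j -> dom j b \/ b \in N j.
  move=> bL; have [bd|nbd] := pselect (dom j b); first by left.
  by right; rewrite mem_undup mem_filter bL andbT; apply/asboolPn.
have N_closed j (b : I j) : b \in N j ->
    forall c, c \in supp (d j (e b)) -> dom j.+1 c \/ c \in N j.+1.
  rewrite mem_undup mem_filter => /andP[_ bL] c cb.
  by apply: LN; apply: closure_supp cb.
have [s [s_dom s_N]] :=
  finite_null_homotopy dom_closed N_uniq N_disj N_closed psi_chain psi_dom.
pose s' j := ladd (sH j) (s j).
pose K j b := dom j b \/ b \in N j.
have s'_dom j (b : I j) : dom j b -> s' j (e b) = sH j (e b).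
  by move=> bd; rewrite mklinE s_dom // addr0.
have s'E j (b : I j) : K j b ->
    phi j (e b) = delta j (s' j (e b)) + s' j.+1 (d j (e b)).
  case=> [bd|bN].
    rewrite s'_dom // sH_dom //; congr (_ + _).
    by apply: eq_on_supp => c /(dom_closed _ _ bd)/s'_dom.
  have h := s_N _ _ bN; rewrite !mklinE linearD addrACA -h !mklinE.
  by rewrite -[_ - _ - _]addrA -opprD addrC subrK.
have K_closed j (b : I j) : K j b ->
    forall c, c \in supp (d j (e b)) -> K j.+1 c.
  by case=> [bd|bN] c cb; [left; apply: dom_closed cb|apply: N_closed cb].
pose G : graph := fun t =>
  let: existT j u := t in K j u.1 /\ u.2 = s' j (e u.1).
have GP : partial_homotopy G.
  split=> [j b v w [_ /= ->] [_ /= ->] //|j b v [/= bK ->]].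
  by exists (s' j.+1); split; [move=> c cb; split=> //=; apply: K_closed cb|apply: s'E].
have HG t : H t -> G t.
  case: t => j [b v] Hv; have bd : dom j b by exists v.
  split; first by left.
  by change (v = s' j (e b)); rewrite s'_dom // (sHE _ _ _ Hv).
have ex : exists b, ~ dom j0 b by exists b0.
have [b1 nb1 b1L] : exists2 b1, ~ dom j0 b1 & b1 \in L j0.
  exists (sval (cid ex)); first exact: (svalP (cid ex)).
  apply: closure_start; rewrite /s0; case: pselect => // h.
  by rewrite (Prop_irrelevance h ex) mem_head.
apply: nb1; exists (s' j0 (e b1)); apply: (Hmax G GP HG).
by split=> //=; apply: LN.
Qed.

Lemma free_null_homotopy : exists s : forall j, {linear F j -> X j},
  forall j x, phi j x = delta j (s j x) + s j.+1 (d j x).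
Proof.
have [H [HP Hmax]] := maximal_partial_homotopy.
have tot := maximal_total HP Hmax; have [Hfun HE] := HP.
have /dependent_choice[s sE] : forall j, exists s : {linear F j -> X j},
    forall b, at_graph H b (s (e b)).
  move=> j; have [v vE] := choice (tot j).
  by have [g gE] := (eF j).2 _ v; exists g => b; rewrite gE.
exists s => j; apply: (free_linear_eq (g := phi j)
  (h := ladd (lcomp (delta j) (s j)) (lcomp (s j.+1) (d j))) (eF j)) => b.
have [u [uG ->]] := HE _ _ _ (sE j b); rewrite !mklinE; congr (_ + _).
by apply: eq_on_supp => c /uG /Hfun; apply.
Qed.

End Maximality.
End FreeComplex.

(** A complex of projectives is a retract of a complex of free modules, with
    differential [i d p] for free covers [p] and sections [i]. *)
Lemma projective_null_homotopy (R : pzRingType) (Q X : nat -> lmodType R)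
    (d : forall j, {linear Q j -> Q j.+1})
    (delta : forall j, {linear X j -> X j.+1})
    (phi : forall j, {linear Q j -> X j.+1}) :
  (forall j, projective (Q j)) ->
  (forall j x, d j.+1 (d j x) = 0) ->
  (forall j x, delta j.+1 (delta j x) = 0) ->
  pure_lifting delta ->
  (forall j x, phi j.+1 (d j x) = delta j.+1 (phi j x)) ->
  exists s : forall j, {linear Q j -> X j},
    forall j x, phi j x = delta j (s j x) + s j.+1 (d j x).
Proof.
move=> hQ dd deltadelta pureX phi_chain.
have /dependent_choice[T TP] : forall j, exists T : {F : lmodType R &
    ((Q j -> F) * {linear F -> Q j} * {linear Q j -> F})%type},
    free_on (projT2 T).1.1 /\
    forall x, (projT2 T).1.2 ((projT2 T).2 x) = x.
  move=> j; have [F [e [q [eF qs]]]] := ex_free_cover (Q j).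
  have [i iK] := projective_split (hQ j) qs.
  by exists (existT _ F (e, q, i)).
pose F j := projT1 (T j); pose e j := (projT2 (T j)).1.1.
pose p j : {linear F j -> Q j} := (projT2 (T j)).1.2.
pose i j : {linear Q j -> F j} := (projT2 (T j)).2.
have eF j : free_on (e j) := (TP j).1.
have iK j x : p j (i j x) = x := (TP j).2 x.
pose d' j := lcomp (i j.+1) (lcomp (d j) (p j)).
have [j x|j x|s sE] := free_null_homotopy (d := d')
  (phi := fun j => lcomp (phi j) (p j)) eF _ deltadelta pureX _.
- by rewrite !mklinE iK dd linear0.
- by rewrite !mklinE iK phi_chain.
exists (fun j => lcomp (s j) (i j)) => j x.
by have := sE j (i j x); rewrite !mklinE iK.
Qed.

(** * Finite injective dimension relative to finitely presented modules *)

Section FiniteDimension.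
Variable R : pzRingType.
Implicit Types A B C D E F G J K L M N P Q S V W X Y Z : lmodType R.

Lemma projective_ext1 P M : projective P -> ext1 P M.
Proof.
move=> hP A B i p [ii ie ps] f; have [s sK] := projective_split hP ps.
have [|u uE] := factor_ker (f := lsub (lid B) (lcomp s p)) ii ie.
  by move=> x; rewrite !mklinE linearB sK subrr.
exists (lcomp f u) => x; rewrite mklinE; congr (f _); apply: ii.
by rewrite uE !mklinE (exact_comp0 _ ie) linear0 subr0.
Qed.

(** By dimension shifting, the vanishing of Ext^k(F, M) for [F] finitely presented
    and [k > m]; in other words SFI-id(M) <= m. *)
Definition vanishing m M :=
  forall F, finitely_presented F -> forall k, (m <= k)%N -> ext1 (iter k (@syz R) F) M.

Lemma SFI_vanishing E : SFI E <-> vanishing 0 E.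
Proof.
split=> h F.
  by move=> hF k _; have /Ext_zero_syz := h k.+1 F isT hF.
by case: F => // k F _ hF; apply/Ext_zero_syz/h.
Qed.

Lemma vanishing_le m m' M : (m <= m')%N -> vanishing m M -> vanishing m' M.
Proof. by move=> mm' h F hF k /(leq_trans mm'); apply: h. Qed.

Lemma vanishing_injective m J : injective_module J -> vanishing m J.
Proof. by move=> hJ F hF k _; apply: injective_ext1. Qed.

Lemma vanishing_cosyz m M : vanishing m.+1 M -> vanishing m (cosyz M).
Proof.
move=> h F hF k mk; apply/ext1_syz_cosyz.
exact: (h F hF k.+1).
Qed.

Lemma vanishing_cosyz_same m M : vanishing m M -> vanishing m (cosyz M).
Proof. by move=> h; apply/vanishing_cosyz/(vanishing_le _ h). Qed.

(** Ext^k(F, C) -> Ext^(k+1)(F, A) -> Ext^(k+1)(F, B) is exact. *)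
Lemma vanishing_kernel m A B C (i : {linear A -> B}) (p : {linear B -> C}) :
  short_exact i p -> vanishing m.+1 B -> vanishing m C -> vanishing m.+1 A.
Proof.
move=> ip hB hC F hF [|k] // mk.
have pX := pr_exact (present (iter k (@syz R) F)).
have hP := @pr_projective _ _ (present (iter k (@syz R) F)).
by apply: (ext1_syzygy_of_quotient ip pX hP);
  [exact: (hB F hF k.+1)|exact: (hC F hF k)].
Qed.

(** Induction on the length, splitting off the first term: its cokernel is the
    kernel of the next differential. *)
Lemma coresolution_vanishing m M : SFI_coresolution M m -> vanishing m M.
Proof.
elim: m M => [|m IHm] M [E [d [e [hE E0 ei ee dE]]]].
  have es : surj e by move=> y; apply/ee/E0.
  have [e' [eK e'K]] := linear_inverse ei es.
  move=> F hF k _; apply: (ext1_isor (f := e')).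
  - by move=> x y /(congr1 e); rewrite !e'K.
  - by move=> x; exists (e x).
  - by have /SFI_vanishing := hE 0%N isT; apply.
have [K [k [ki ke]]] := ex_ker (d 1%N).
have [u uE] : exists u : {linear E 0%N -> K}, forall x, k (u x) = d 0%N x.
  apply: (factor_ker (f := d 0%N) ki ke) => x.
  exact: (exact_comp0 _ (dE 0%N)).
have eu : short_exact e u.
  split=> // [y|y]; first by rewrite -(inj_eq0 _ ki) uE; apply: ee.
  by have /dE[x xE] := exact_comp0 y ke; exists x; apply: ki; rewrite uE.
apply: (vanishing_kernel eu).
  by apply: (@vanishing_le 0) => //; apply/SFI_vanishing/hE.
apply: IHm; exists (fun i => E i.+1), (fun i => d i.+1), k; split=> // i im.
  exact: hE.
exact: E0.
Qed.

(** Injective modules are used for all terms but the last, which is the [m]-th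
    cosyzygy. *)
Lemma vanishing_coresolution m M : vanishing m M -> SFI_coresolution M m.
Proof.
elim: m M => [|m IHm] M hM.
  exists (fun i => if i is 0%N then M else ('rV[R]_0 : lmodType R)).
  exists (fun i => lzero _ _), (lid M); split=> //.
  - by case=> // _; apply/SFI_vanishing.
  - by case=> // i _ x; apply: thinmx0.
  - by move=> y; split=> // _; exists y.
  - move=> i y; split=> // _; exists 0; rewrite linear0.
    by apply: esym; apply: thinmx0.
have [E [d [e [hE E0 ei ee dE]]]] := IHm _ (vanishing_cosyz hM).
have [Ji Je Js] := co_exact (copresent M).
pose E' i := if i is j.+1 then E j else co_mod (copresent M).
pose d' i : {linear E' i -> E' i.+1} :=
  if i is j.+1 then d j else lcomp e (co_map (copresent M)).
exists E', d', (co_in (copresent M)); split=> //.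
- case=> [_|i im]; last exact: hE.
  by apply/SFI_vanishing/vanishing_injective/co_injective.
- by case=> // i im x; apply: E0.
- by move=> y; rewrite mklinE (inj_eq0 _ ei); apply: Je.
- case=> [|i] //= y; rewrite ee; split=> [[z <-]|[x <-]]; last by exists (co_map _ x).
  by have [x <-] := Js z; exists x.
Qed.

Lemma enat_minP (A : nat -> Prop) m : enat_min A = Some m -> A m.
Proof.
rewrite /enat_min; case: pselect => // h [<-].
by case: ex_minnP => k /asboolP.
Qed.

Lemma SFI_vee_vanishing m M : vanishing m M -> SFI_vee M.
Proof.
move=> /vanishing_coresolution h; rewrite /SFI_vee /SFI_id /enat_min.
by case: pselect => // -[]; exists m; apply/asboolP.
Qed.

Lemma vanishing_SFI_vee n M :
  le_enat (fin_SFI R) (Some n) -> SFI_vee M -> vanishing n M.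
Proof.
rewrite /fin_SFI /enat_sup; case E: (enat_min _) => [k|] //= kn hM.
have /(_ _ (ex_intro2 _ _ M hM erefl)) := enat_minP E.
move: hM; rewrite /SFI_vee; case Em: (SFI_id M) => [m|] //= _ mk.
apply: (vanishing_le (leq_trans mk kn)).
exact/coresolution_vanishing/(enat_minP Em).
Qed.

(** * Extensions of Gorenstein projective modules *)

Lemma Gorenstein_next G : Gorenstein_projective G ->
  exists P G' (k : {linear G -> P}) (q : {linear P -> G'}),
    [/\ short_exact k q, projective P & Gorenstein_projective G'].
Proof.
move=> [P [d [[hP dE hQ] [i [k [ki ke]]]]]].
have [K [k' [k'i k'e]]] := ex_ker (d (i + 1)).
have [u uE] : exists u : {linear P i -> K}, forall x, k' (u x) = d i x.
  by apply: (factor_ker (f := d i) k'i k'e) => x; apply: (exact_comp0 _ (dE i)).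
exists (P i), K, k, u; split=> //; last by exists P, d; split=> //; exists (i + 1), k'.
split=> // y; first by rewrite -(inj_eq0 _ k'i) uE; apply: ke.
by have /dE[x xE] := exact_comp0 y k'e; exists x; apply: k'i; rewrite uE.
Qed.

Lemma Gorenstein_previous G : Gorenstein_projective G ->
  exists P G' (k : {linear G' -> P}) (q : {linear P -> G}),
    [/\ short_exact k q, projective P & Gorenstein_projective G'].
Proof.
move=> [P [d [[hP dE hQ] [i [k [ki ke]]]]]].
have [j ij] : exists j, i = j + 1 by exists (i - 1); rewrite subrK.
move: k ki ke; rewrite {}ij => k ki ke.
have [K [k' [k'i k'e]]] := ex_ker (d j).
have [u uE] : exists u : {linear P j -> G}, forall x, k (u x) = d j x.
  by apply: (factor_ker (f := d j) ki ke) => x; apply: (exact_comp0 _ (dE j)).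
exists (P j), K, k', u; split=> //; last by exists P, d; split=> //; exists j, k'.
split=> // y; first by rewrite -(inj_eq0 _ ki) uE; apply: k'e.
by have /dE[x xE] := exact_comp0 y ke; exists x; apply: ki; rewrite uE.
Qed.

(** A solution of the linear system with matrix [r] is a map from the cokernel of
    [r], which is finitely presented and therefore lifts. *)
Lemma pure_surjection A B C (i : {linear A -> B}) (q : {linear B -> C}) m p
    (r : 'I_p -> 'I_m -> R) (z : 'I_m -> C) :
  short_exact i q -> (forall F, finitely_presented F -> ext1 F A) ->
  (forall k, \sum_j r k j *: z j = 0) ->
  exists y : 'I_m -> B,
    (forall j, q (y j) = z j) /\ (forall k, \sum_j r k j *: y j = 0).
Proof.
move=> iq hA rz; pose T : 'M[R]_(p, m) := \matrix_(k, j) r k j.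
have fl : linear (fun v : 'rV[R]_p => v *m T).
  by move=> a x y; rewrite mulmxDl scalemxAl.
have zl : linear (fun v : 'rV[R]_m => \sum_j v 0 j *: z j).
  move=> a x y; rewrite scaler_sumr -big_split; apply: eq_bigr => j _.
  by rewrite !mxE scalerDl scalerA.
pose f : {linear 'rV[R]_p -> 'rV[R]_m} := mklin fl.
pose zeta : {linear 'rV[R]_m -> C} := mklin zl.
have zetaE j : zeta (delta_mx 0 j) = z j.
  rewrite mklinE (bigD1 j) //= mxE !eqxx scale1r big1 ?addr0 // => j' jj'.
  by rewrite mxE eqxx /= (negPf jj') scale0r.
have fE k : f (delta_mx 0 k) = \sum_j r k j *: delta_mx 0 j.
  rewrite mklinE -rowE; apply/rowP => j; rewrite mxE mxE summxE (bigD1 j) //=.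
  rewrite !mxE !eqxx mulr1 big1 ?addr0 // => j' jj'.
  by rewrite !mxE eqxx eq_sym (negPf jj') mulr0.
have [F [g [gs gN]]] := ex_quot (im_submodule f).
have hF : finitely_presented F by exists p, m, f, g.
have zetaf v : zeta (f v) = 0.
  rewrite [v]row_sum_delta linear_sum linear_sum big1 // => k _.
  rewrite !linearZZ fE linear_sum.
  by under eq_bigr do rewrite linearZZ zetaE; rewrite rz scaler0.
have [h hE] := factor_coker gs gN zetaf.
have [h' h'E] := ext1_lift h (hA F hF) iq.
exists (fun j => h' (g (delta_mx 0 j))); split=> [j|k].
  by rewrite h'E hE zetaE.
transitivity (h' (g (f (delta_mx 0 k)))).
  by rewrite fE !linear_sum; apply: eq_bigr => j _; rewrite !linearZ.
by rewrite (exact_comp0 _ gN) linear0.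
Qed.

(** The data iterated to produce the right half of a complete resolution. *)
Record embedding A := Embedding {
  em_mod : lmodType R;
  em_quot : lmodType R;
  em_in : {linear A -> em_mod};
  em_map : {linear em_mod -> em_quot};
  em_projective : projective em_mod;
  em_exact : short_exact em_in em_map;
  em_Gorenstein : Gorenstein_projective em_quot }.

Lemma embedding_inhabited G : Gorenstein_projective G -> inhabited (embedding G).
Proof.
by move=> /Gorenstein_next[P [G' [k [q [kq hP hG']]]]]; constructor; apply: Embedding kq hG'.
Qed.

Definition embedding_of G (hG : Gorenstein_projective G) : embedding G :=
  inhabited_witness (embedding_inhabited hG).

(** Let [G0 -> P] have cokernel [G]. A map from [G0] to [E] extends to a chain map
    [phi] from the coresolution of [G0] by projectives to an injective
    coresolution of [E]. The latter augmented by [E] is pure exact, so that [phi]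
    is null homotopic, and the first component of the homotopy is the required
    extension to [P]. *)
Lemma Gorenstein_ext1_SFI G E : Gorenstein_projective G -> vanishing 0 E -> ext1 G E.
Proof.
move=> hG hE; have [P [G0 [k0 [q0 [kq0 hP hG0]]]]] := Gorenstein_previous hG.
apply: (ext1_presentation hP kq0) => f0.
pose fix tower n : {A : lmodType R & embedding A} :=
  if n is m.+1 then
    existT _ _ (embedding_of (@em_Gorenstein _ (projT2 (tower m))))
  else existT _ G0 (Embedding hP kq0 hG).
pose g n := projT1 (tower n); pose em n : embedding (g n) := projT2 (tower n).
pose c n := iter n (@cosyz R) E; pose co n := copresent (c n).
have hc n F : finitely_presented F -> ext1 F (c n).
  move=> hF; have : vanishing 0 (c n).
    by elim: n => //= n; apply: vanishing_cosyz_same.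
  by move/(_ F hF 0%N isT).
pose Q n := em_mod (em n); pose I n := co_mod (co n).
have step n (f : {linear g n -> c n}) : exists f' : {linear g n.+1 -> c n.+1},
    exists phi : {linear Q n -> I n},
      (forall x, phi (em_in (em n) x) = co_in (co n) (f x)) /\
      (forall x, co_map (co n) (phi x) = f' (em_map (em n) x)).
  have [ii ie ps] := em_exact (em n); have [ji je js] := co_exact (co n).
  have [phi phiE] := @co_injective _ _ (co n) _ _ _ (lcomp (co_in (co n)) f) ii.
  have [|f' f'E] := factor_coker (f := lcomp (co_map (co n)) phi) ps ie.
    by move=> x; rewrite mklinE phiE mklinE (exact_comp0 _ je).
  by exists f', phi; split.
have [f [f_0 /dependent_choice[phi phiE]]] := dependent_recursion f0 step.
(* The augmented complex: [E] sits in degree 0, whence the shift by one. *)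
pose X j := if j is i.+1 then I i else E.
pose delta j : {linear X j -> X j.+1} :=
  if j is i.+1 then lcomp (co_in (co i.+1)) (co_map (co i)) else co_in (co 0%N).
pose d j : {linear Q j -> Q j.+1} := lcomp (em_in (em j.+1)) (em_map (em j)).
have hQ j : projective (Q j) by apply: em_projective.
have dd j x : d j.+1 (d j x) = 0.
  have [_ e _] := em_exact (em j.+1).
  by rewrite !mklinE (exact_comp0 _ e) linear0.
have deltadelta j x : delta j.+1 (delta j x) = 0.
  case: j x => [|j] x /=; rewrite ?mklinE.
    by have [_ e _] := co_exact (co 0%N); rewrite (exact_comp0 _ e) linear0.
  by have [_ e _] := co_exact (co j.+1); rewrite (exact_comp0 _ e) linear0.
have pureX : pure_lifting delta.
  move=> j m p r z dz rz; have [ei ee es] := co_exact (co j).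
  have /choice[z' z'E] i : exists y, co_in (co j) y = z i.
    apply/ee; have [ei' _ _] := co_exact (co j.+1).
    by apply/(inj_eq0 _ ei'); apply: dz.
  have rz' k : \sum_i r k i *: z' i = 0.
    apply: ei; rewrite linear_sum linear0 -[RHS](rz k).
    by apply: eq_bigr => i _; rewrite linearZ z'E.
  case: j z dz rz z' z'E rz' {ei ee es} => [|j] z dz rz z' z'E rz'.
    by exists z'.
  have [y [yE ry]] := pure_surjection (co_exact (co j)) (hc j) rz'.
  by exists y; split=> // i; rewrite mklinE yE z'E.
have phi_chain j x : phi j.+1 (d j x) = delta j.+1 (phi j x).
  have [_ h1] := phiE j; have [h2 _] := phiE j.+1.
  by rewrite !mklinE h2 h1.
have [s sE] := projective_null_homotopy hQ dd deltadelta pureX phi_chain.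
exists (s 0%N) => x; have [ei ee _] := co_exact (co 0%N); apply: ei.
have [h _] := phiE 0%N; rewrite -f_0; apply: etrans (h x).
have [_ e _] := em_exact (em 0%N).
by rewrite (sE 0%N) /= (exact_comp0 _ e) linear0 linear0 addr0.
Qed.

(** Ext^1(G, V) = Ext^2(G', V) = Ext^1(G', V'), where [G'] is again Gorenstein
    projective and the cosyzygy [V'] of [V] has smaller dimension. *)
Lemma Gorenstein_ext1 m G V : Gorenstein_projective G -> vanishing m V -> ext1 G V.
Proof.
elim: m G V => [|m IHm] G V hG hV; first exact: Gorenstein_ext1_SFI.
have [P [G' [k [q [kq hP hG']]]]] := Gorenstein_next hG.
apply: (ext1_syzygy_of_quotient (co_exact (copresent V)) kq hP).
  exact/injective_ext1/co_injective.
by apply: IHm => //; apply: vanishing_cosyz.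
Qed.

End FiniteDimension.

(** * The left orthogonal class of the modules of finite dimension *)

Section Orthogonal.
Variables (R : pzRingType) (n : nat).
Implicit Types A B C D E F G J K L M N P Q S V W X Y Z : lmodType R.

Definition orthogonal X := forall V, vanishing n V -> ext1 X V.

Lemma ex_presented_cokernel p q (f : {linear 'rV[R]_p -> 'rV[R]_q}) :
  exists F, exists g : {linear 'rV[R]_q -> F}, exact f g /\ surj g.
Proof. by have [F [g [gs gN]]] := ex_quot (im_submodule f); exists F, g. Qed.

(** The construction of special embeddings needs a small family of test modules;
    indexing them by matrices provides one. *)
Definition test_index : Type :=
  {p : nat & {q : nat & {linear 'rV[R]_p -> 'rV[R]_q}}} * {k : nat | (n <= k)%N}.

Definition test_module (t : test_index) : lmodType R :=
  iter (sval t.2) (@syz R) (sval (cid (ex_presented_cokernel (projT2 (projT2 t.1))))).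

Lemma test_moduleP V : (forall t, ext1 (test_module t) V) <-> vanishing n V.
Proof.
split=> [h F [p [q [f [g [fg gs]]]]] k nk|h [[p [q f]] [k nk]]].
  have := h (existT _ p (existT _ q f), exist _ k nk); rewrite /test_module /=.
  case: cid => F0 [g0 [fg0 gs0]] /=; rewrite !ext1_iter_syz.
  have [|u uE] := factor_coker (f := g0) gs fg.
    by move=> x; apply: exact_comp0 fg0.
  apply: (ext1_isol (f := u)).
    apply: inj_ker0 => y; have [x <-] := gs y.
    by rewrite uE => /fg0[z <-]; apply: exact_comp0 fg.
  by move=> y; have [x <-] := gs0 y; exists (g x).
rewrite /test_module /=; case: cid => F0 [g0 [fg0 gs0]] /=.
by apply: h => //; exists p, q, f, g0.
Qed.

Lemma orthogonal_embedding M : exists W C (m : {linear M -> W}) (p : {linear W -> C}),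
  [/\ short_exact m p, vanishing n W & orthogonal C].
Proof.
have [W [C [m [p [mp hW hC]]]]] := special_embedding test_module M.
exists W, C, m, p; split=> //; first exact/test_moduleP.
by move=> V /test_moduleP; apply: hC.
Qed.

(** The modules of dimension at most [n] are closed under cosyzygies. *)
Lemma orthogonal_syz X : orthogonal X -> orthogonal (syz X).
Proof. by move=> h V hV; apply/ext1_syz_cosyz/h/vanishing_cosyz_same. Qed.

Lemma test_module_orthogonal F k :
  finitely_presented F -> (n <= k)%N -> orthogonal (iter k (@syz R) F).
Proof. by move=> hF nk V; apply. Qed.

(** A special cover of [M] is the pushout of a special embedding of the kernel
    of a projective presentation. *)
Lemma orthogonal_cover M : exists X W (f : {linear W -> X}) (g : {linear X -> M}),
  [/\ orthogonal X, vanishing n W & short_exact f g].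
Proof.
have [K P k q hP [ki ke qs]] := present M.
have [W [C [m [p [[mi me ps] hW hC]]]]] := orthogonal_embedding K.
pose a := lpair m (lsub (lzero K P) k).
have [X [c [cs cN]]] := ex_quot (im_submodule a).
have c_im z : c z = 0 <-> exists x, z = (m x, - k x).
  rewrite cN; split=> -[x xE]; exists x; last first.
    by rewrite xE mklinE mklinE mklinE sub0r.
  by rewrite -xE mklinE mklinE mklinE sub0r.
pose f := lcomp c (lpair (lid W) (lzero W P)).
pose h := lcomp c (lpair (lzero P W) (lid P)).
have fE w : f w = c (w, 0) by [].
have hE x : h x = c (0, x) by [].
have cE w x : c (w, x) = f w + h x.
  by rewrite fE hE -linearD pairD addr0 add0r.
have fi : injective f.
  apply: inj_ker0 => w; rewrite fE => /c_im[x [-> /esym/eqP]].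
  by rewrite oppr_eq0 => /eqP/(inj_eq0 _ ki) ->; rewrite linear0.
have hi : injective h.
  apply: inj_ker0 => y; rewrite hE => /c_im[x [/esym/(inj_eq0 _ mi) -> ->]].
  by rewrite linear0 oppr0.
have [|g gE] := factor_surj (f := lcomp q (lsnd W P)) cs.
  move=> z /c_im[x ->]; rewrite mklinE mklinE /= linearN.
  by rewrite (exact_comp0 _ ke) oppr0.
have [|r rE] := factor_surj (f := lcomp p (lfst W P)) cs.
  by move=> z /c_im[x ->]; rewrite mklinE mklinE /= (exact_comp0 _ me).
have fg : short_exact f g.
  split=> // [y|y]; last by have [x <-] := qs y; exists (c (0, x)); rewrite gE.
  have [[w x] <-] := cs y; rewrite gE -[lcomp _ _ _]/(q x).
  split=> [/ke[z <-]|[w' w'E]].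
    exists (w + m z); apply/eqP; rewrite -subr_eq0 fE -linearB; apply/eqP/c_im.
    by exists z; rewrite pairN pairD sub0r addrC addKr.
  by have := congr1 g w'E; rewrite fE !gE !mklinE /= linear0 => <-.
have hr : short_exact h r.
  split=> // [y|y]; last by have [w <-] := ps y; exists (c (w, 0)); rewrite rE.
  have [[w x] <-] := cs y; rewrite rE -[lcomp _ _ _]/(p w).
  split=> [/me[z <-]|[x' x'E]].
    exists (x + k z); apply/eqP; rewrite -subr_eq0 hE -linearB; apply/eqP/c_im.
    by exists (- z); rewrite !linearN opprK pairN pairD sub0r [x + _]addrC addrK.
  by have := congr1 r x'E; rewrite hE !rE !mklinE /= linear0 => <-.
exists X, W, f, g; split=> // V hV.
by apply: (ext1_extension hr); [apply: projective_ext1|apply: hC].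
Qed.

Hypothesis projective_vanishing : forall P, projective P -> vanishing n P.
Hypothesis vanishing_bounded : forall m M, vanishing m M -> vanishing n M.

(** A module in both classes is a direct summand of a projective module: the
    kernel of a projective presentation has finite dimension as well. *)
Lemma orthogonal_vanishing_projective X :
  orthogonal X -> vanishing n X -> projective X.
Proof.
move=> hX nX; have [K P k q hP kq] := present X.
have nK : vanishing n K.
  apply: (@vanishing_bounded n.+1); apply: (vanishing_kernel kq) => //.
  by apply: vanishing_le (projective_vanishing hP).
have [s sK] := ext1_split (hX _ nK) kq.
exact: projective_retract sK hP.
Qed.

Definition linked X X' := exists P (k : {linear X -> P}) (q : {linear P -> X'}),
  projective P /\ short_exact k q.

(** The middle term of a special embedding of [X] lies in both classes, hence is
    projective. *)
Lemma orthogonal_next X : orthogonal X -> exists X', orthogonal X' /\ linked X X'.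
Proof.
move=> hX; have [W [C [m [p [mp hW hC]]]]] := orthogonal_embedding X.
exists C; split=> //; exists W, m, p; split=> //.
apply: orthogonal_vanishing_projective => // V hV.
by apply: (ext1_extension mp); [apply: hX|apply: hC].
Qed.

(** The cycles [Z i] are built outwards from [X] by special embeddings on one side
    and syzygies on the other; splicing gives a complex, which stays exact under
    maps to a projective [Q] because all [Z i] are orthogonal to [Q]. *)
Lemma orthogonal_Gorenstein X : orthogonal X -> Gorenstein_projective X.
Proof.
move=> hX; pose T (_ : nat) := {Y : lmodType R | orthogonal Y}.
have [i t|u [u0 uE]] := @dependent_recursion T
    (fun _ t t' => linked (sval t) (sval t')) (exist _ X hX).
  have [Y [hY l]] := orthogonal_next (svalP t).
  by exists (exist _ Y hY).
have [i t|v [v0 vE]] := @dependent_recursion T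
    (fun _ t t' => linked (sval t') (sval t)) (exist _ X hX).
  exists (exist _ _ (orthogonal_syz (svalP t))).
  exists (pr_mod (present (sval t))), (pr_in _), (pr_map _).
  by split; [apply: pr_projective|apply: pr_exact].
pose Z (i : int) : lmodType R :=
  match i with Posz j => sval (u j) | Negz j => sval (v j.+1) end.
have hZ i : orthogonal (Z i) by case: i => j; apply: (svalP _).
have Zl i : linked (Z i) (Z (i + 1)).
  case: i => [j|[|j]].
  - by rewrite -PoszD addn1; apply: uE.
  - have h := vE 0%N; rewrite v0 -u0 in h; exact: h.
  - have -> : Negz j.+1 + 1 = Negz j; last exact: vE.
    by rewrite !NegzE -[j.+2]addn1 PoszD opprD subrK.
have /dependent_choice[S SP] : forall i, exists S : {P : lmodType R &
    ({linear Z i -> P} * {linear P -> Z (i + 1)%R})%type},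
    projective (projT1 S) /\ short_exact (projT2 S).1 (projT2 S).2.
  move=> i; have [P [k [q h]]] := Zl i.
  by exists (existT _ P (k, q)).
pose P i := projT1 (S i).
pose k i : {linear Z i -> P i} := (projT2 (S i)).1.
pose q i : {linear P i -> Z (i + 1)} := (projT2 (S i)).2.
have kq i : short_exact (k i) (q i) := (SP i).2.
pose d i : {linear P i -> P (i + 1)} := lcomp (k (i + 1)) (q i).
have kd i : exact (k i) (d i).
  have [_ ke _] := kq i; have [ki' _ _] := kq (i + 1).
  by move=> y; rewrite mklinE (inj_eq0 _ ki').
exists P, d; split; last first.
  exists 0; have [ki _ _] := kq 0.
  have -> : X = Z 0 by rewrite /= u0.
  by exists (k 0).
split=> [i|i y|Q hQ i f]; first exact: (SP i).1.
  have [_ _ qs] := kq i.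
  split=> [/kd[z <-]|[x <-]]; first by have [x <-] := qs z; exists x.
  by apply/kd; exists (q i x).
have [_ _ qs] := kq i.
split=> [f0|[g gE] x].
  have [_ ke' qs'] := kq (i + 1).
  have [|f' f'E] := factor_coker (f := f) qs' ke'.
    by move=> z; have [x <-] := qs z; rewrite -[RHS](f0 x).
  have [g gE] := hZ (i + 1 + 1 + 1) Q (projective_vanishing hQ)
                    _ _ _ _ (kq (i + 1 + 1)) f'.
  by exists g => x; rewrite mklinE gE f'E.
rewrite gE -[RHS](linear0 g); congr (g _).
by apply: (exact_comp0 (i := k (i + 1))) => //; apply: kd.
Qed.

(** The test modules are orthogonal to everything of dimension at most [n], hence
    themselves Gorenstein projective. *)
Lemma rperp1_Gorenstein_vanishing M :
  rperp1 (@Gorenstein_projective R) M -> vanishing n M.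
Proof.
move=> h F hF k nk; have hS := test_module_orthogonal hF nk.
by have /Ext_zero_cosyz := h _ (orthogonal_Gorenstein hS).
Qed.

Lemma vanishing_rperp_Gorenstein M :
  vanishing n M -> rperp (@Gorenstein_projective R) M.
Proof.
move=> h [|i] A // _ hA; apply/Ext_zero_cosyz/(Gorenstein_ext1 (m := n)) => //.
by elim: i => //= i; apply: vanishing_cosyz_same.
Qed.

End Orthogonal.

Theorem corollary3p4 (R : pzRingType) (n : nat)
    (hP : subclass (@projective R) (@SFI_vee R))
    (hfin : le_enat (fin_SFI R) (Some n)) :
  [/\ cotorsion_pair (@Gorenstein_projective R)
        (rperp (@Gorenstein_projective R)),
      hereditary_pair (@Gorenstein_projective R)
        (rperp (@Gorenstein_projective R))
    & complete_pair (@Gorenstein_projective R)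
        (rperp (@Gorenstein_projective R))].
Proof.
have hPn (P : lmodType R) : projective P -> vanishing n P.
  by move=> pP; apply: (vanishing_SFI_vee hfin (hP P pP)).
have hW m (M : lmodType R) : vanishing m M -> vanishing n M.
  by move=> hM; apply: (vanishing_SFI_vee hfin (SFI_vee_vanishing hM)).
split; last 1 first.
- move=> M; have [X [W [f [g [hX hW' [fi fg gs]]]]]] := orthogonal_cover n M.
  exists X, W, f, g; split=> //; first exact: orthogonal_Gorenstein hX.
  exact: (vanishing_rperp_Gorenstein hW').
- split=> M; split=> hM.
  + by move=> B hB; apply: hB.
  + apply: (orthogonal_Gorenstein hPn hW) => V hV.
    by have /Ext_zero_cosyz := hM V (vanishing_rperp_Gorenstein hV).
  + by move=> A; apply: hM.
  + exact: (vanishing_rperp_Gorenstein (rperp1_Gorenstein_vanishing hPn hW hM)).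
- by move=> i A B i1 hA hB; apply: hB.
Qed.
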